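(* Let $\mathsf A$ be a Cartan matrix of type $A_n$, $D_n$, $E_6$ or $E_7$, and let $i$ be an index such that $\Lambda_i$ is a dominant minuscule weight. Let $b\in B(\Lambda_i)$ and $\xi=\mathrm{wt}(b)$. Let $\mathcal P(b)$, $\mathcal S(b)$ and $c_{\nu,\mu}$ be as defined in the context. Then: (1) $\mathcal S(b)$ (with the action given in the context) is a homogeneous simple $R^{\Lambda_i}(\xi)$-module. (2) The cyclotomic quiver Hecke algebra $R^{\Lambda_i}(\xi)$ has a $\mathbf k$-basis $$\mathcal C(b):=\{c_{\nu,\mu}\mid \nu,\mu\in\mathcal P(b)\}.$$
   Context: Setting. $\mathbf k$ is a field, $I=\{1,\dots,n\}$ ($I=\{1,\dots,6\}$, $\{1,\dots,7\}$ for $E_6,E_7$), $\mathsf A=(a_{ij})$ the Cartan matrix, with simple roots $\alpha_i$, simple coroots $h_i$, fundamental weights $\Lambda_i$, weight lattice $\mathsf P$, $\langle h_i,\alpha_j\rangle=a_{ij}$, $\langle h_j,\Lambda_i\rangle=\delta_{ij}$, Weyl group $\mathsf W$ generated by $s_i(\lambda)=\lambda-\langle h_i,\lambda\rangle\alpha_i$, and invariant symmetric form with $(\alpha_i,\alpha_j)=\mathsf d_ia_{ij}$ ($\mathsf d_i$ relatively prime positive integers). $\mathsf Q_+=\sum_i\mathbb Z_{\ge0}\alpha_i$ and $\mathrm{ht}(\sum k_i\alpha_i)=\sum k_i$. A weight $\lambda$ is minuscule if $\langle\alpha^\vee,\lambda\rangle\in\{0,\pm1\}$ for all roots $\alpha$.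 The (nonzero) dominant minuscule weights are: type $A_n$ (chain $1-2-\cdots-n$): all $\Lambda_i$; type $D_n$ (nodes $1,2$ both joined to $3$, chain $3-4-\cdots-n$): $\Lambda_1,\Lambda_2,\Lambda_n$; type $E_6$ (chain $1-2-3-5-6$, node $4$ joined to $3$): $\Lambda_1,\Lambda_6$; type $E_7$ (chain $1-2-3-5-6-7$, node $4$ joined to $3$): $\Lambda_7$. Crystal. For $\Lambda_i$ minuscule, the crystal $B(\Lambda_i)$ of the irreducible highest weight $U_q(\mathfrak g)$-module $V(\Lambda_i)$ is identified with the orbit $\mathsf W\cdot\Lambda_i$, each element having itself as weight, with $\tilde f_j(\mu)=\mu-\alpha_j$ if $\langle h_j,\mu\rangle=1$ and $\tilde f_j(\mu)=0$ otherwise; the highest weight element is $b_{\Lambda_i}=\Lambda_i$. Quiver Hecke algebra. Fix polynomials $Q_{i,j}(u,v)=(1-\delta_{i,j})\sum t_{i,j;p,q}u^pv^q\in\mathbf k[u,v]$, the sum over $(p,q)\in\mathbb Z_{\ge0}^2$ with $(\alpha_i,\alpha_i)p+(\alpha_j,\alpha_j)q=-2(\alpha_i,\alpha_j)$, where $t_{i,j;p,q}=t_{j,i;q,p}$ and $t_{i,j;-a_{ij},0}\in\mathbf k^\times$; assume $Q_{i,j}=1$ whenever $(\alpha_i,\alpha_j)=0$. For $\beta\in\mathsf Q_+$ with $\mathrm{ht}(\beta)=N$, let $I^\beta=\{\nu\in I^N\mid\sum_k\alpha_{\nu_k}=\beta\}$, with $\mathfrak S_N=\langle s_1,\dots,s_{N-1}\rangle$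 acting by place permutation, $(w\nu)_k=\nu_{w^{-1}(k)}$. $R(\beta)$ is the $\mathbf k$-algebra generated by $e(\nu)$ ($\nu\in I^\beta$), $x_k$ ($1\le k\le N$), $\tau_m$ ($1\le m\le N-1$) with relations: $e(\nu)e(\nu')=\delta_{\nu,\nu'}e(\nu)$, $\sum_\nu e(\nu)=1$; $x_kx_m=x_mx_k$, $x_ke(\nu)=e(\nu)x_k$; $\tau_me(\nu)=e(s_m\nu)\tau_m$; $\tau_k\tau_m=\tau_m\tau_k$ if $|k-m|>1$; $\tau_k^2e(\nu)=Q_{\nu_k,\nu_{k+1}}(x_k,x_{k+1})e(\nu)$; $(\tau_kx_m-x_{s_k(m)}\tau_k)e(\nu)$ equals $-e(\nu)$ if $m=k,\nu_k=\nu_{k+1}$, equals $e(\nu)$ if $m=k+1,\nu_k=\nu_{k+1}$, and $0$ otherwise; $(\tau_{k+1}\tau_k\tau_{k+1}-\tau_k\tau_{k+1}\tau_k)e(\nu)$ equals $\frac{Q_{\nu_k,\nu_{k+1}}(x_k,x_{k+1})-Q_{\nu_k,\nu_{k+1}}(x_{k+2},x_{k+1})}{x_k-x_{k+2}}e(\nu)$ if $\nu_k=\nu_{k+2}$, and $0$ otherwise. It is $\mathbb Z$-graded by $\deg e(\nu)=0$, $\deg x_ke(\nu)=(\alpha_{\nu_k},\alpha_{\nu_k})$, $\deg\tau_le(\nu)=-(\alpha_{\nu_l},\alpha_{\nu_{l+1}})$. For each $w\in\mathfrak S_N$ fix a reduced expression $w=s_{k_1}\cdots s_{k_r}$ and set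 $\tau_w=\tau_{k_1}\cdots\tau_{k_r}$. For a dominant integral weight $\Lambda$, the cyclotomic quiver Hecke algebra is $R^\Lambda(\Lambda-\beta)=R(\beta)/I^\Lambda_\beta$, where $I^\Lambda_\beta$ is the two-sided ideal generated by $x_N^{\langle h_{\nu_N},\Lambda\rangle}e(\nu)$, $\nu\in I^\beta$. A graded module is homogeneous if it is concentrated in a single degree. Paths. For $b\in B(\Lambda_i)$ let $\xi=\mathrm{wt}(b)$, $\beta=\Lambda_i-\xi$, $\ell=\mathrm{ht}(\beta)$ and $\mathcal P(b)=\{(i_1,\dots,i_\ell)\in I^\ell\mid\tilde f_{i_1}\cdots\tilde f_{i_\ell}b_{\Lambda_i}=b\}$. Any two $\nu,\mu\in\mathcal P(b)$ are connected by successive exchanges of adjacent entries $j,k$ with $a_{jk}=0$; $w_{\nu,\mu}\in\mathfrak S_\ell$ denotes the resulting permutation with $\nu=w_{\nu,\mu}\mu$ (i.e. the unique such permutation preserving the relative order of equal entries). Set $c_{\nu,\mu}:=e(\nu)\tau_{w_{\nu,\mu}}e(\mu)$ (its image in $R^{\Lambda_i}(\xi)$). Module. $\mathcal S(b)=\bigoplus_{\nu\in\mathcal P(b)}\mathbf k\,\mathsf p(\nu)$ (placed in degree $0$), with $R(\beta)$-action $e(\mu)\mathsf p(\nu)=\delta_{\nu,\mu}\mathsf p(\nu)$, $x_ke(\mu)\mathsf p(\nu)=0$, and $\tau_je(\mu)\mathsf p(\nu)=\mathsf p(s_j\nu)$ if $\nu=\mu$ and $s_j\nu\in\mathcal P(b)$,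 and $0$ otherwise. *)

(* Defs.v *)
From HB Require Import structures.
From mathcomp Require Import all_boot all_order all_algebra all_fingroup.
From mathcomp Require Import generic_quotient ring_quotient boolp.
From mathcomp Require Import monalg.

Set Implicit Arguments.
Unset Strict Implicit.
Unset Printing Implicit Defensive.

Import GRing.Theory.
Local Open Scope ring_scope.

(* MathComp's algType excludes the zero ring, but a cyclotomic quotient of
   R(beta) can be zero; and Hierarchy Builder does not allow a new structure
   below algType that joins rings and modules.  So an algebra over k is given
   as a ring with a central ring morphism from k. *)
HB.mixin Record isPzAlgebra (k : comNzRingType) A of GRing.PzRing A := {
  algin : k -> A;
  algin_zmod_morphism : zmod_morphism algin;
  algin_monoid_morphism : monoid_morphism algin;
  algin_central : forall c a, algin c * a = a * algin c
}.

#[short(type="pzAlgType")]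
HB.structure Definition PzAlgebra (k : comNzRingType) :=
  { A of GRing.PzRing A & isPzAlgebra k A }.

HB.instance Definition _ (k : comNzRingType) (A : pzAlgType k) :=
  GRing.isZmodMorphism.Build k A (@algin k A) algin_zmod_morphism.
HB.instance Definition _ (k : comNzRingType) (A : pzAlgType k) :=
  GRing.isMonoidMorphism.Build k A (@algin k A) algin_monoid_morphism.

Section IdealQuotient.
Variables (k : comNzRingType) (A : pzAlgType k) (G : A -> Prop).

Inductive in_ideal : A -> Prop :=
| in_ideal0 : in_ideal 0
| in_idealD a b : in_ideal a -> in_ideal b -> in_ideal (a + b)
| in_ideal_gen a g b : G g -> in_ideal (a * g * b).

Definition ideal_pred : {pred A} := fun a => `[< in_ideal a >].

Lemma in_idealN a : in_ideal a -> in_ideal (- a).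
Proof.
elim=> [|x y _ IHx _ IHy|x g y Gg]; first by rewrite oppr0; exact: in_ideal0.
- by rewrite opprD; exact: in_idealD.
- by rewrite -!mulNr; exact: in_ideal_gen.
Qed.

Lemma in_idealM a b c : in_ideal b -> in_ideal (a * b * c).
Proof.
elim=> [|x y _ IHx _ IHy|x g y Gg].
- by rewrite mulr0 mul0r; exact: in_ideal0.
- by rewrite mulrDr mulrDl; exact: in_idealD.
- rewrite !mulrA -[a * x * g * y * c]mulrA; exact: in_ideal_gen.
Qed.

Lemma ideal_predP a : reflect (in_ideal a) (a \in ideal_pred).
Proof. by rewrite unfold_in; exact: asboolP. Qed.

Lemma ideal_pred_zmod_closed : zmod_closed ideal_pred.
Proof.
split; first exact/ideal_predP/in_ideal0.
move=> a b /ideal_predP Ia /ideal_predP Ib.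
by apply/ideal_predP/in_idealD => //; exact: in_idealN.
Qed.

HB.instance Definition _ :=
  GRing.isZmodClosed.Build A ideal_pred ideal_pred_zmod_closed.

Definition quotAlg := Quotient.quot ideal_pred.
HB.instance Definition _ := GRing.Zmodule.on quotAlg.

Definition qproj (a : A) : quotAlg := \pi_(Quotient.quot ideal_pred)%qT a.
Definition qrepr (q : quotAlg) : A := repr (q : Quotient.quot ideal_pred).

Lemma qreprK : cancel qrepr qproj.
Proof. by move=> q; exact: reprK. Qed.

Lemma qprojE a b : qproj a = qproj b <-> in_ideal (a - b).
Proof.
split=> [/eqP|].
  by rewrite -[_ == _]/(_ == _ %[mod Quotient.quot ideal_pred])%qT
             -Quotient.idealrBE => /ideal_predP.
by move=> /ideal_predP; rewrite Quotient.idealrBE => /eqP.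
Qed.

Lemma qproj_eq0 a : qproj a = 0 <-> in_ideal a.
Proof.
have -> : 0 = qproj 0 by rewrite /qproj pi_zeror.
by rewrite qprojE subr0.
Qed.

Lemma qproj_zmod_morphism : zmod_morphism qproj.
Proof. by move=> a b; exact: raddfB. Qed.

HB.instance Definition _ :=
  GRing.isZmodMorphism.Build A quotAlg qproj qproj_zmod_morphism.

Definition qone : quotAlg := qproj 1.
Definition qmul (p q : quotAlg) : quotAlg := qproj (qrepr p * qrepr q).
Lemma qrepr_proj a : in_ideal (qrepr (qproj a) - a).
Proof. by apply/qprojE; rewrite qreprK. Qed.

Lemma qprojM_subproof a b : qmul (qproj a) (qproj b) = qproj (a * b).
Proof.
apply/qprojE.
have -> : qrepr (qproj a) * qrepr (qproj b) - a * b
  = (1 * (qrepr (qproj a) - a) * qrepr (qproj b))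
    + (a * (qrepr (qproj b) - b) * 1).
  by rewrite mul1r mulr1 mulrBl mulrBr addrA subrK.
by apply: in_idealD; apply: in_idealM; exact: qrepr_proj.
Qed.

Lemma qmulA : associative qmul.
Proof.
move=> x y z; rewrite -(qreprK x) -(qreprK y) -(qreprK z).
by rewrite !qprojM_subproof mulrA.
Qed.

Lemma qmul1q : left_id qone qmul.
Proof. by move=> x; rewrite -(qreprK x) !qprojM_subproof mul1r. Qed.

Lemma qmulq1 : right_id qone qmul.
Proof. by move=> x; rewrite -(qreprK x) !qprojM_subproof mulr1. Qed.

Lemma qmulDl : left_distributive qmul +%R.
Proof.
move=> x y z; rewrite -(qreprK x) -(qreprK y) -(qreprK z) -raddfD.
by rewrite !qprojM_subproof mulrDl raddfD.
Qed.

Lemma qmulDr : right_distributive qmul +%R.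
Proof.
move=> x y z; rewrite -(qreprK x) -(qreprK y) -(qreprK z) -raddfD.
by rewrite !qprojM_subproof mulrDr raddfD.
Qed.

HB.instance Definition _ := GRing.Zmodule_isPzRing.Build quotAlg
  qmulA qmul1q qmulq1 qmulDl qmulDr.

Lemma qproj_monoid_morphism : monoid_morphism qproj.
Proof. by split=> // a b; rewrite -qprojM_subproof. Qed.

HB.instance Definition _ :=
  GRing.isMonoidMorphism.Build A quotAlg qproj qproj_monoid_morphism.

Definition qalgin (c : k) : quotAlg := qproj (algin c).

Lemma qalgin_zmod_morphism : zmod_morphism qalgin.
Proof. by move=> c1 c2; rewrite /qalgin !raddfB. Qed.

Lemma qalgin_monoid_morphism : monoid_morphism qalgin.
Proof. by split=> [|c1 c2]; rewrite /qalgin ?rmorph1 ?rmorphM. Qed.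

Lemma qalgin_central c q : qalgin c * q = q * qalgin c.
Proof. by rewrite -(qreprK q) /qalgin -!rmorphM /= algin_central. Qed.

HB.instance Definition _ := isPzAlgebra.Build k quotAlg
  qalgin_zmod_morphism qalgin_monoid_morphism qalgin_central.

Definition qscale (c : k) (q : quotAlg) : quotAlg := algin c * q.

Lemma qscaleA c1 c2 q : qscale c1 (qscale c2 q) = qscale (c1 * c2) q.
Proof. by rewrite /qscale mulrA rmorphM. Qed.

Lemma qscale1 : left_id 1 qscale.
Proof. by move=> q; rewrite /qscale rmorph1 mul1r. Qed.

Lemma qscaleDr : right_distributive qscale +%R.
Proof. by move=> c p q; rewrite /qscale mulrDr. Qed.

Lemma qscaleDl q : {morph qscale^~ q : c1 c2 / c1 + c2}.
Proof. by move=> c1 c2; rewrite /qscale rmorphD mulrDl. Qed.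

HB.instance Definition _ := GRing.Zmodule_isLmodule.Build k quotAlg
  qscaleA qscale1 qscaleDr qscaleDl.

End IdealQuotient.

Section FreeAlgebra.
Variables (k : comNzRingType) (X : choiceType).

Definition freeAlg := {malg k[{fmonom X}]}.
HB.instance Definition _ := GRing.Lalgebra.on freeAlg.

Definition fgen (x : X) : freeAlg := mkmalgU (fmu x) 1.

Lemma free_scalerAr (c : k) (a b : freeAlg) : c *: (a * b) = a * (c *: b).
Proof.
rewrite -!mul_malgC mulrA [RHS]mulrA; congr (_ * _).
rewrite /malgC !malgM_def fgmulUg fgmulgU; apply: eq_bigr => m _.
by rewrite mul1m mulm1 mulrC.
Qed.

HB.instance Definition _ :=
  GRing.Lalgebra_isAlgebra.Build k freeAlg free_scalerAr.

Definition free_algin (c : k) : freeAlg := c%:A.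

Lemma free_algin_zmod_morphism : zmod_morphism free_algin.
Proof. by move=> c1 c2; rewrite /free_algin scalerBl. Qed.

Lemma free_algin_monoid_morphism : monoid_morphism free_algin.
Proof.
by split=> [|c1 c2]; rewrite /free_algin ?scale1r // mulr_algl scalerA.
Qed.

Lemma free_algin_central c a : free_algin c * a = a * free_algin c.
Proof. by rewrite /free_algin mulr_algl mulr_algr. Qed.

HB.instance Definition _ := isPzAlgebra.Build k freeAlg
  free_algin_zmod_morphism free_algin_monoid_morphism free_algin_central.

End FreeAlgebra.

Inductive dynkin := DynkinA of nat | DynkinD of nat | DynkinE6 | DynkinE7.

Definition dynkin_wf (X : dynkin) : bool :=
  match X with
  | DynkinA n => 0 < n
  | DynkinD n => 4 <= n
  | DynkinE6 | DynkinE7 => true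
  end%N.

Definition rank (X : dynkin) : nat :=
  match X with
  | DynkinA n => n
  | DynkinD n => n
  | DynkinE6 => 6
  | DynkinE7 => 7
  end.

(* The edges, each oriented from its smaller to its larger end, with nodes
   numbered from 1. *)
Definition edge (X : dynkin) (i j : nat) : bool :=
  match X with
  | DynkinA _ => j == i.+1
  | DynkinD _ => ((i, j) \in [:: (1, 3); (2, 3)]) || ((3 <= i) && (j == i.+1))
  | DynkinE6 => (i, j) \in [:: (1, 2); (2, 3); (3, 5); (5, 6); (3, 4)]
  | DynkinE7 => (i, j) \in [:: (1, 2); (2, 3); (3, 5); (5, 6); (6, 7); (3, 4)]
  end%N.

(* The element i of 'I_(rank X) stands for the node i.+1. *)
Definition cartan (X : dynkin) : 'M[int]_(rank X) :=
  \matrix_(i, j)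
    if i == j then 2
    else if edge X i.+1 j.+1 || edge X j.+1 i.+1 then -1 else 0.

Section Weights.
Variables (n : nat) (A : 'M[int]_n).

(* d_1, .., d_n are relatively prime positive integers that make (d_i a_ij)
   symmetric. *)
Definition symmetrizer (d : 'I_n -> nat) : Prop :=
  [/\ forall i, (0 < d i)%N,
      \big[gcdn/0%N]_(i < n) d i = 1%N
    & forall i j, (d i)%:Z * A i j = (d j)%:Z * A j i].

(* The weight lattice, in the basis of fundamental weights: the i-th
   coordinate of la is <h_i, la>. *)
Definition weight := 'rV[int]_n.
(* The coroot lattice, in the basis of simple coroots h_i. *)
Definition coweight := 'rV[int]_n.

Definition pairing (h : coweight) (la : weight) : int :=
  \sum_(i < n) h 0 i * la 0 i.

Definition fweight (i : 'I_n) : weight := delta_mx 0 i.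
Definition scoroot (i : 'I_n) : coweight := delta_mx 0 i.
Definition sroot (j : 'I_n) : weight := \row_i A i j.

Definition reflw (i : 'I_n) (la : weight) : weight :=
  la - pairing (scoroot i) la *: sroot i.
Definition reflc (i : 'I_n) (h : coweight) : coweight :=
  h - pairing h (sroot i) *: scoroot i.

(* mu lies in the Weyl group orbit of la *)
Definition weyl_orbit (la mu : weight) : Prop :=
  exists w : seq 'I_n, mu = foldr reflw la w.

(* The coroot of the root w(alpha_j) is w(h_j). *)
Definition is_coroot (h : coweight) : Prop :=
  exists (w : seq 'I_n) (j : 'I_n), h = foldr reflc (scoroot j) w.

Definition dominant (la : weight) : Prop :=
  forall i, 0 <= pairing (scoroot i) la.

Definition minuscule (la : weight) : Prop :=
  forall h, is_coroot h -> pairing h la \in [:: 0; 1; -1].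

(* The crystal B(la), la dominant minuscule, is the orbit weyl_orbit la, each
   element being its own weight; None is the 0 of the crystal. *)
Definition ftilde (j : 'I_n) (mu : weight) : option weight :=
  if pairing (scoroot j) mu == 1 then Some (mu - sroot j) else None.

(* Q_+, in the basis of simple roots *)
Definition posroot := 'rV[nat]_n.
Definition ht (beta : posroot) : nat := (\sum_(i < n) beta ord0 i)%N.
Definition weight_of (beta : posroot) : weight :=
  \sum_(i < n) sroot i *+ beta 0 i.

End Weights.

Notation Iseq n N := {ffun 'I_N -> 'I_n}.

Section Sequences.
Variables (n N : nat).
Implicit Types (nu : Iseq n N) (w : 'S_N).

(* For m < N.-1, the positions m and m.+1. *)
Fact lo_subproof (m : 'I_N.-1) : (m < N)%N.
Proof. exact: leq_trans (ltn_ord m) (leq_pred N). Qed.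
Definition lo (m : 'I_N.-1) : 'I_N := Ordinal (lo_subproof m).

Fact hi_subproof (m : 'I_N.-1) : (m.+1 < N)%N.
Proof. by case: N m => [[]|N'] // m; rewrite ltnS. Qed.
Definition hi (m : 'I_N.-1) : 'I_N := Ordinal (hi_subproof m).

Definition stransp (m : 'I_N.-1) : 'S_N := tperm (lo m) (hi m).

Definition place w nu : Iseq n N := [ffun k => nu (w^-1%g k)].

(* The product s_{k_1} .. s_{k_r} as a composition of functions; in MathComp
   (u * v)%g applies u first. *)
Definition word_perm (s : seq 'I_N.-1) : 'S_N :=
  foldr (fun k w => (w * stransp k)%g) 1%g s.

Definition reduced_expression w (s : seq 'I_N.-1) : Prop :=
  word_perm s = w /\
  forall s', word_perm s' = w -> (size s <= size s')%N.

End Sequences.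

(* exchanges A mu nu w: a succession of exchanges of adjacent entries j, l
   with a_jl = 0 leads from mu to nu, and w is the resulting permutation. *)
Inductive exchanges n (A : 'M[int]_n) N (mu : Iseq n N) :
    Iseq n N -> 'S_N -> Prop :=
| exchanges0 : exchanges A mu mu 1%g
| exchangesS nu w (m : 'I_N.-1) :
    exchanges A mu nu w -> A (nu (lo m)) (nu (hi m)) = 0 ->
    exchanges A mu (place (stransp m) nu) (w * stransp m)%g.

Section ExchangesUnique.
Variables (n : nat) (A : 'M[int]_n) (N : nat) (mu : Iseq n N).
Hypothesis Adiag : forall j, A j j != 0.

Lemma stransp_ltn (m : 'I_N.-1) (a b : 'I_N) : (a < b)%N ->
  ~ (a = lo m /\ b = hi m) -> (stransp m a < stransp m b)%N.
Proof.
move=> ab nab; rewrite /stransp.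
case: (tpermP (lo m) (hi m) a) => [ea|ea|/eqP na1 /eqP na2];
case: (tpermP (lo m) (hi m) b) => [eb|eb|/eqP nb1 /eqP nb2]; subst=> //.
- by case: nab.
- by rewrite ltn_neqAle (ab : (lo m < b)%N) andbT; apply/eqP => /val_inj/esym/eqP; exact/negP.
- exact: ltnW.
- exact: ltnW.
- rewrite ltn_neqAle -ltnS (ab : (a < hi m)%N) andbT.
  by apply/eqP => /val_inj/eqP; exact/negP.
Qed.

Lemma exchangesP nu w : exchanges A mu nu w ->
  nu = place w mu /\
  forall k l : 'I_N, (k < l)%N -> mu k = mu l -> (w k < w l)%N.
Proof.
elim=> [|{}nu {}w m _ [nuE wlt] Am0].
  split=> [|k l kl _]; last by rewrite !perm1.
  by apply/ffunP => k; rewrite ffunE invg1 perm1.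
split=> [|k l kl mukl].
  apply/ffunP => k; rewrite nuE !ffunE invMg permM; congr (mu _).
rewrite !permM; apply: stransp_ltn; first exact: wlt.
move=> [wk wl]; have : nu (lo m) = nu (hi m).
  by rewrite -wk -wl nuE !ffunE !permK.
by move=> e; move: (Adiag (nu (hi m))); rewrite -[in X in A X _]e Am0 eqxx.
Qed.

Lemma exchanges_unique nu w1 w2 :
  exchanges A mu nu w1 -> exchanges A mu nu w2 -> w1 = w2.
Proof.
move=> /exchangesP[nu1 lt1] /exchangesP[nu2 lt2].
have muE1 k : nu (w1 k) = mu k by rewrite nu1 ffunE permK.
have muE2 k : nu (w2 k) = mu k by rewrite nu2 ffunE permK.
have key (u v : 'S_N) (k : 'I_N) :
    (forall j, nu (u j) = mu j) -> (forall j, nu (v j) = mu j) ->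
    (forall j l : 'I_N, (j < l)%N -> mu j = mu l -> (v j < v l)%N) ->
    (forall j : 'I_N, (j < k)%N -> u j = v j) -> (v k <= u k)%N.
  move=> uE vE vlt IH; rewrite leqNgt; apply/negP => uv.
  pose j := (v^-1)%g (u k); have vj : v j = u k by rewrite permKV.
  have muj : mu j = mu k by rewrite -vE vj uE.
  case: (ltngtP j k) => [jk|kj|/val_inj jk].
  - by move: (IH _ jk); rewrite vj => /perm_inj ejk; rewrite ejk ltnn in jk.
  - by move: (vlt _ _ kj (esym muj)); rewrite vj ltnNge (ltnW uv).
  - by rewrite -vj jk ltnn in uv.
apply/permP => k; have [a] := ubnP (k : nat); elim: a k => // a IH k ka.
have IHk (j : 'I_N) : (j < k)%N -> w1 j = w2 j.
  by move=> jk; apply: IH; exact: leq_trans jk _.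
apply/val_inj/eqP; rewrite eqn_leq /= !key // => j jk.
by rewrite IHk.
Qed.

End ExchangesUnique.

(* The permutation w_{nu,mu}; it is unique when it exists, by
   exchanges_unique. *)
Definition exchange_perm n (A : 'M[int]_n) N (nu mu : Iseq n N) : 'S_N :=
  odflt 1%g [pick w : 'S_N | `[< exchanges A mu nu w >]].

(* The set P(b), for b of height N below La in the crystal. *)
Definition paths n (A : 'M[int]_n) (La b : weight n) N : {set Iseq n N} :=
  [set nu : Iseq n N | foldr (fun j => obind (ftilde A j)) (Some La) (codom nu)
            == Some b].

Section Qpolynomials.
Variables (k : fieldType) (n : nat) (A : 'M[int]_n) (d : 'I_n -> nat).

Definition form (i j : 'I_n) : int := (d i)%:Z * A i j.

Definition Qsupp (i j : 'I_n) (p q : nat) : bool :=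
  form i i * p%:Z + form j j * q%:Z == - (2 * form i j).

Variable t : 'I_n -> 'I_n -> nat -> nat -> k.

(* Q_{i,j}(u,v), with u = 'X the inner and v = 'Y the outer variable.  The
   bound on the exponents holds on the support since (alpha_i, alpha_i) > 0. *)
Definition Qpoly (i j : 'I_n) : {poly {poly k}} :=
  \poly_(q < `|2 * form i j|.+1) \poly_(p < `|2 * form i j|.+1)
    (if (i != j) && Qsupp i j p q then t i j p q else 0).

Definition Qparam : Prop :=
  [/\ forall i j p q, i != j -> Qsupp i j p q -> t i j p q = t j i q p,
      forall i j, i != j -> t i j `|A i j| 0 != 0
    & forall i j, form i j = 0 -> Qpoly i j = 1].

End Qpolynomials.

Section Evaluation.
Variables (k : fieldType) (F : algType k).

(* P(a, b), for commuting a and b *)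
Definition eval2 (P : {poly {poly k}}) (a b : F) : F :=
  \sum_(q < size P) \sum_(p < size P`_q) P`_q`_p *: (a ^+ p * b ^+ q).

(* (P(a, b) - P(c, b)) / (a - c), for commuting a, b and c, by means of
   (a^p - c^p) / (a - c) = \sum_(r < p) a^(p-1-r) c^r *)
Definition divdiff (P : {poly {poly k}}) (a b c : F) : F :=
  \sum_(q < size P) \sum_(p < size P`_q)
    P`_q`_p *: ((\sum_(r < p) a ^+ (p.-1 - r) * c ^+ r) * b ^+ q).

Lemma divdiffE (P : {poly {poly k}}) (a b c : F) : GRing.comm a c ->
  (a - c) * divdiff P a b c = eval2 P a b - eval2 P c b.
Proof.
move=> ac; rewrite /divdiff /eval2 mulr_sumr -sumrB; apply: eq_bigr => q _.
rewrite mulr_sumr -sumrB; apply: eq_bigr => p _.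
by rewrite -scalerAr -scalerBr mulrA -subrXX_comm // mulrBl.
Qed.

End Evaluation.

Section QuiverHecke.
Variables (k : fieldType) (n : nat) (A : 'M[int]_n) (d : 'I_n -> nat).
Variables (t : 'I_n -> 'I_n -> nat -> nat -> k) (beta : posroot n).

Local Notation N := (ht beta).
Local Notation I_N := (Iseq n N).

(* The set I^beta. *)
Definition Ibeta : {set I_N} :=
  [set nu : I_N | \sum_(l < N) delta_mx 0 (nu l) == beta].

(* The generators e(nu), x_l and tau_m, in this order. *)
Definition qhgen : Type := ({nu : I_N | nu \in Ibeta} + 'I_N + 'I_N.-1)%type.
HB.instance Definition _ := Choice.on qhgen.

Local Notation F := (freeAlg k qhgen).

(* The generator e(nu) for nu in I^beta; 0 for other sequences. *)
Definition gen_e (nu : I_N) : F :=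
  if insub nu is Some nu' then fgen k (inl (inl nu') : qhgen) else 0.
Definition gen_x (l : 'I_N) : F := fgen k (inl (inr l) : qhgen).
Definition gen_tau (m : 'I_N.-1) : F := fgen k (inr m : qhgen).

Local Notation Q := (Qpoly A d t).

(* The elements of the free algebra that vanish in R(beta); positions and
   crossings are numbered from 0. *)
Inductive qhrel : F -> Prop :=
| qhrel_ee nu nu' : nu \in Ibeta -> nu' \in Ibeta ->
    qhrel (gen_e nu * gen_e nu' - if nu == nu' then gen_e nu else 0)
| qhrel_e1 : qhrel (\sum_(nu in Ibeta) gen_e nu - 1)
| qhrel_xx l m : qhrel (gen_x l * gen_x m - gen_x m * gen_x l)
| qhrel_xe l nu : nu \in Ibeta ->
    qhrel (gen_x l * gen_e nu - gen_e nu * gen_x l)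
| qhrel_te m nu : nu \in Ibeta ->
    qhrel (gen_tau m * gen_e nu - gen_e (place (stransp m) nu) * gen_tau m)
| qhrel_tt (l m : 'I_N.-1) : ((l.+1 < m) || (m.+1 < l))%N ->
    qhrel (gen_tau l * gen_tau m - gen_tau m * gen_tau l)
| qhrel_t2 l nu : nu \in Ibeta ->
    qhrel (gen_tau l ^+ 2 * gen_e nu
           - eval2 (Q (nu (lo l)) (nu (hi l))) (gen_x (lo l)) (gen_x (hi l))
             * gen_e nu)
| qhrel_tx l m nu : nu \in Ibeta ->
    qhrel ((gen_tau l * gen_x m - gen_x (stransp l m) * gen_tau l) * gen_e nu
           - if (m == lo l) && (nu (lo l) == nu (hi l)) then - gen_e nu
             else if (m == hi l) && (nu (lo l) == nu (hi l)) then gen_e nu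
             else 0)
| qhrel_braid (l m : 'I_N.-1) nu : m = l.+1 :> nat -> nu \in Ibeta ->
    qhrel ((gen_tau m * gen_tau l * gen_tau m
            - gen_tau l * gen_tau m * gen_tau l) * gen_e nu
           - if nu (lo l) == nu (hi m)
             then divdiff (Q (nu (lo l)) (nu (hi l)))
                    (gen_x (lo l)) (gen_x (hi l)) (gen_x (hi m)) * gen_e nu
             else 0).

Definition quiverHecke := quotAlg qhrel.
HB.instance Definition _ := PzAlgebra.on quiverHecke.
HB.instance Definition _ := GRing.Lmodule.on quiverHecke.

Definition qh_e (nu : I_N) : quiverHecke := qproj qhrel (gen_e nu).
Definition qh_x (l : 'I_N) : quiverHecke := qproj qhrel (gen_x l).
Definition qh_tau (m : 'I_N.-1) : quiverHecke := qproj qhrel (gen_tau m).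

(* qhdeg r a: a lies in the component of degree r of R(beta), which is spanned
   by the products of generators e(nu), x_l e(nu), tau_m e(nu) of total
   degree r. *)
Inductive qhdeg : int -> quiverHecke -> Prop :=
| qhdeg_e nu : nu \in Ibeta -> qhdeg 0 (qh_e nu)
| qhdeg_x l nu : nu \in Ibeta ->
    qhdeg (form A d (nu l) (nu l)) (qh_x l * qh_e nu)
| qhdeg_tau m nu : nu \in Ibeta ->
    qhdeg (- form A d (nu (lo m)) (nu (hi m))) (qh_tau m * qh_e nu)
| qhdegM r s a b : qhdeg r a -> qhdeg s b -> qhdeg (r + s) (a * b)
| qhdeg0 r : qhdeg r 0
| qhdegD r a b : qhdeg r a -> qhdeg r b -> qhdeg r (a + b)
| qhdegZ r (c : k) a : qhdeg r a -> qhdeg r (c *: a).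

Definition qh_tauw (rex : 'S_N -> seq 'I_N.-1) (w : 'S_N) : quiverHecke :=
  \prod_(m <- rex w) qh_tau m.

Section Cyclotomic.
Variable La : weight n.

(* The generators of the cyclotomic ideal: there is none when N = 0, and l is
   the last position otherwise. *)
Inductive cycrel : quiverHecke -> Prop :=
| CycRel (l : 'I_N) (nu : I_N) : l.+1 = N -> nu \in Ibeta ->
    cycrel (qh_x l ^+ `|pairing (scoroot (nu l)) La| * qh_e nu).

(* R^La(La - beta) *)
Definition cyclotomicQH := quotAlg cycrel.
HB.instance Definition _ := PzAlgebra.on cyclotomicQH.
HB.instance Definition _ := GRing.Lmodule.on cyclotomicQH.

Definition cycproj : quiverHecke -> cyclotomicQH := qproj cycrel.

Definition cycdeg (r : int) (a : cyclotomicQH) : Prop :=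
  exists2 a', qhdeg r a' & a = cycproj a'.

End Cyclotomic.
End QuiverHecke.

Arguments cycdeg {k n} A d t {beta} La r a.

Section Modules.
Variables (k : comNzRingType) (A : pzAlgType k) (V : lmodType k).
Variable act : A -> V -> V.

Definition is_module : Prop :=
  [/\ forall v, act 1 v = v,
      forall a a' v, act (a * a') v = act a (act a' v),
      forall a a' v, act (a + a') v = act a v + act a' v,
      forall a u v, act a (u + v) = act a u + act a v
    & forall c v, act (algin c) v = c *: v].

Definition is_submodule (U : V -> Prop) : Prop :=
  [/\ U 0, forall u v, U u -> U v -> U (u + v)
    & forall a u, U u -> U (act a u)].

Definition is_simple : Prop :=
  (exists v : V, v != 0) /\
  forall U, is_submodule U -> (forall v, U v -> v = 0) \/ (forall v, U v).

(* V is the direct sum of the subspaces gr r, and A_r V_s is contained in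
   V_{r+s}. *)
Definition is_graded (degA : int -> A -> Prop) (gr : int -> V -> Prop) : Prop :=
  [/\ forall r, [/\ gr r 0, forall u v, gr r u -> gr r v -> gr r (u + v)
                  & forall (c : k) u, gr r u -> gr r (c *: u)],
      forall v, exists (s : seq int) (f : int -> V),
        (forall r, gr r (f r)) /\ v = \sum_(r <- s) f r,
      forall (s : seq int) (f : int -> V), uniq s -> (forall r, gr r (f r)) ->
        \sum_(r <- s) f r = 0 -> forall r, r \in s -> f r = 0
    & forall r s a v, degA r a -> gr s v -> gr (r + s) (act a v)].

Definition is_homogeneous (gr : int -> V -> Prop) : Prop :=
  exists r0, forall r v, gr r v -> r <> r0 -> v = 0.

(* the grading that places all of V in degree r0 *)
Definition placed_in (r0 r : int) (v : V) : Prop := r = r0 \/ v = 0.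

End Modules.

Arguments placed_in {k V} r0 r v.

Definition is_basis (k : pzRingType) (V : lmodType k) (I : finType)
    (fam : I -> V) : Prop :=
  (forall v, exists f : I -> k, v = \sum_i f i *: fam i) /\
  (forall f : I -> k, \sum_i f i *: fam i = 0 -> forall i, f i = 0).

Section Smodule.
Variables (k : fieldType) (n : nat) (A : 'M[int]_n) (d : 'I_n -> nat).
Variables (t : 'I_n -> 'I_n -> nat -> nat -> k) (La b : weight n).
Variable beta : posroot n.

Local Notation N := (ht beta).
Local Notation P := (paths A La b N).
Local Notation e := (qh_e A d t).
Local Notation x := (qh_x A d t).
Local Notation tau := (qh_tau A d t).
Local Notation R := (cyclotomicQH A d t beta La).
Local Notation "\pi a" := (cycproj La a) (at level 10, a at level 8).

Definition pathType : finType := {nu : Iseq n N | nu \in P}.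

Definition Smod := {ffun pathType -> k^o}.
HB.instance Definition _ := GRing.Lmodule.on Smod.

(* p(nu) for nu in P(b); 0 for other sequences *)
Definition pvec (nu : Iseq n N) : Smod :=
  [ffun nu' : pathType => (val nu' == nu)%:R].

Definition Saction (act : R -> Smod -> Smod) : Prop :=
  [/\ forall mu nu, mu \in Ibeta beta -> nu \in P ->
        act (\pi (e mu)) (pvec nu) = if nu == mu then pvec nu else 0,
      forall l mu nu, mu \in Ibeta beta -> nu \in P ->
        act (\pi (x l * e mu)) (pvec nu) = 0
    & forall m mu nu, mu \in Ibeta beta -> nu \in P ->
        act (\pi (tau m * e mu)) (pvec nu)
        = if (nu == mu) && (place (stransp m) nu \in P)
          then pvec (place (stransp m) nu) else 0].

(* The image of c_{nu,mu} in the cyclotomic quotient; rex gives the chosen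
   reduced expressions. *)
Definition cvec (rex : 'S_N -> seq 'I_N.-1) (nu mu : pathType) : R :=
  \pi (e (val nu)
       * qh_tauw A d t rex (exchange_perm A (val nu) (val mu)) * e (val mu)).

End Smodule.

Arguments Smod k {n} A La b beta.
Arguments cvec {k n} A d t La b {beta} rex nu mu.

(* Main.v *)
(** The simply laced minuscule case is elementary: no dimension formula for
    cyclotomic quotients is needed.

    Weights of B(La) pair with each h_j to 0, 1 or -1.  Hence consecutive
    entries of a path may be exchanged exactly when they are orthogonal, a path
    never contains j l j with a_jl = -1, and two paths to the same weight differ
    by exchanges; this makes the action on S(b) satisfy the relations, and S(b)
    simple.

    For the spanning part, one shows by induction on the suffix v that in the
    cyclotomic algebra every dot on a strand of v kills e(uv), and that e(uv) = 0
    unless v is a path.  A new letter j in front of v = l v' is moved to the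
    right if a_jl = 0; if j = l the nilHecke relations give e = -x tau e =
    -tau x e, whence e = e^2 = 0; if a_jl = -1 then tau^2 e = 0 is a unit times
    x e, and, when j pairs to -1 with the weight of v', v' may be assumed to
    start with j, and the braid relation on j l j gives e = 0.

    So in the quotient only the tau_w remain, and they satisfy the Coxeter
    relations along exchanges.  Sorting a path by bubbling letters to the front
    shows that an element tau_s e(mu) with s a word of exchanges depends only on
    its end points.  Finally a reduced word of w_{nu,mu} only exchanges orthogonal
    neighbours, since in a reduced word no two strands cross twice.  The c_{nu,mu}
    therefore span, and they act on S(b) as matrix units. *)
Require Import Defs.
From mathcomp Require Import all_boot all_order all_algebra all_fingroup.
From mathcomp Require Import finmap monalg zify ring.
From mathcomp Require boolp.

Set Implicit Arguments.
Unset Strict Implicit.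
Unset Printing Implicit Defensive.

Import GRing.Theory Num.Theory Order.TTheory.
Local Open Scope ring_scope.

(** * Paths in the crystal *)

Section Exchange.
Variables (n : nat) (A : 'M[int]_n).

Inductive exch (s : seq 'I_n) : seq 'I_n -> Prop :=
| exch_refl : exch s s
| exch_step u a c v : exch s (u ++ a :: c :: v) -> A a c = 0 ->
    exch s (u ++ c :: a :: v).

Lemma exch_trans s2 s1 s3 : exch s1 s2 -> exch s2 s3 -> exch s1 s3.
Proof. by move=> e12; elim=> // u a c v _; exact: exch_step. Qed.

Lemma exch_cons j s1 s2 : exch s1 s2 -> exch (j :: s1) (j :: s2).
Proof.
elim=> [|u a c v _ IH Aac]; first exact: exch_refl.
exact: (@exch_step _ (j :: u)).
Qed.

Lemma exch_perm s1 s2 : exch s1 s2 -> perm_eq s1 s2.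
Proof.
elim=> // u a c v _ /permPl-> _; rewrite perm_cat2l.
by rewrite -[[:: a, c & v]]/([:: a; c] ++ v) -[[:: c, a & v]]/([:: c; a] ++ v)
  perm_cat2r (perm_catC [:: a] [:: c]).
Qed.

Lemma exch_size s1 s2 : exch s1 s2 -> size s1 = size s2.
Proof. by move/exch_perm/perm_size. Qed.

End Exchange.

(** * Weights along a path, and connectivity of the paths to a given weight *)

Section Descent.
Variables (n : nat) (A : 'M[int]_n) (La : weight n).

(** The Hecke algebra arguments use the Cartan matrix through these properties; finite type enters
    only through [cartan_inj]. *)
Definition simply_laced : Prop :=
  [/\ forall j, A j j = 2, forall j l, A j l = A l j
    & forall j l, j != l -> A j l = 0 \/ A j l = -1].

Hypothesis (Asl : simply_laced).
Hypotheses (La_dom : dominant La) (La_min : minuscule A La).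

(** The crystal operators of a word, rightmost letter first, with [None] for the zero of the
    crystal. Lists instead of sequences of fixed length allow induction on suffixes. *)
Definition descend (s : seq 'I_n) : option (weight n) :=
  foldr (fun j => obind (ftilde A j)) (Some La) s.

Let Adiag j : A j j = 2. Proof. by case: Asl. Qed.
Let Asym j l : A j l = A l j. Proof. by case: Asl. Qed.
Let Aoff j l : j != l -> A j l = 0 \/ A j l = -1.
Proof. by case: Asl => _ _; exact. Qed.

Lemma pairing_scoroot j (mu : weight n) : pairing (scoroot j) mu = mu 0 j.
Proof.
rewrite /pairing (bigD1 j) //= big1 ?addr0 => [|l lj]; rewrite !mxE !eqxx.
  by rewrite mul1r.
by rewrite (negPf lj) mul0r.
Qed.

Lemma pairing_reflw h j (mu : weight n) :
  pairing h (reflw A j mu) = pairing (reflc A j h) mu.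
Proof.
have pB (g : coweight n) (x y : weight n) (c : int) :
    pairing g (x - c *: y) = pairing g x - c * pairing g y.
  rewrite /pairing mulr_sumr -sumrB; apply: eq_bigr => l _.
  by rewrite !mxE; ring.
have pBl (g h' : coweight n) (x : weight n) (c : int) :
    pairing (g - c *: h') x = pairing g x - c * pairing h' x.
  rewrite /pairing mulr_sumr -sumrB; apply: eq_bigr => l _.
  by rewrite !mxE; ring.
by rewrite /reflw /reflc pB pBl mulrC.
Qed.

Lemma descend_cons j s mu : descend (j :: s) = Some mu <->
  exists2 mu', descend s = Some mu' & mu' 0 j = 1 /\ mu = mu' - sroot A j.
Proof.
rewrite /= -/(descend s); case: (descend s) => [mu'|] /=; last by split=> // -[].
rewrite /ftilde pairing_scoroot; case: eqP => [mu'j|nmu'j]; last first.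
  by split=> // -[_ [<-] []].
by split=> [[<-]|[_ [<-] [_ ->]]] //; exists mu'.
Qed.

Lemma descend_catN u v : descend v = None -> descend (u ++ v) = None.
Proof. by elim: u => //= j u IH /IH; rewrite /descend /= => ->. Qed.

Lemma descend_cat u v mu :
  descend (u ++ v) = Some mu -> exists nu, descend v = Some nu.
Proof.
by move=> op; case E: (descend v) => [nu|]; [exists nu | rewrite descend_catN in op].
Qed.

Lemma descend_catl u v1 v2 :
  descend v1 = descend v2 -> descend (u ++ v1) = descend (u ++ v2).
Proof. by rewrite /descend !foldr_cat => ->. Qed.

(** Each step of a descent subtracts a simple root from a weight of pairing 1, hence is a simple
    reflection. Moved over to the coroot, it reduces the claim to [La] being minuscule. *)
Lemma descend_minuscule s mu j :
  descend s = Some mu -> mu 0 j \in [:: 0; 1; -1].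
Proof.
(* Reflections turn a simple coroot into other coroots, so the induction needs all of them. *)
suff H h : is_coroot A h -> descend s = Some mu ->
    pairing h mu \in [:: 0; 1; -1].
  by rewrite -pairing_scoroot; apply: H; exists [::], j.
elim: s h mu => [|l s IH] h mu hc; first by move=> [<-]; exact: La_min.
case/descend_cons=> mu' op' [mul ->].
have -> : mu' - sroot A l = reflw A l mu'.
  by rewrite /reflw pairing_scoroot mul scale1r.
rewrite pairing_reflw; apply: IH op'.
by case: hc => w [m ->]; exists (l :: w), m.
Qed.

Lemma descend_weight s mu :
  descend s = Some mu -> mu = La - \sum_(j <- s) sroot A j.
Proof.
elim: s mu => [|j s IH] mu; first by move=> [<-]; rewrite big_nil subr0.
by case/descend_cons=> mu' /IH-> [_ ->]; rewrite big_cons opprD addrCA addrC.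
Qed.

Lemma descend_swap a c s : A a c = 0 ->
  descend [:: a, c & s] = descend [:: c, a & s].
Proof.
move=> Aac; have Aca : A c a = 0 by rewrite Asym.
rewrite /= -/(descend s); case: (descend s) => //= mu.
rewrite /ftilde !pairing_scoroot.
case: eqP => [mc|nmc]; case: eqP => [ma|nma] //=;
  rewrite !pairing_scoroot !mxE ?Aac ?Aca subr0 ?ma ?mc ?eqxx //.
- by rewrite addrAC.
- by move/eqP: nma => /negPf->.
- by move/eqP: nmc => /negPf->.
Qed.

Lemma descend_exch s1 s2 : exch A s1 s2 -> descend s1 = descend s2.
Proof.
elim=> // u a c v _ -> Aac; exact/descend_catl/descend_swap.
Qed.

(** In a path, the weight of [v] pairs to 1 with h_c and to 1 + [A a c] with h_a, which excludes
    [a = c]. The opposite order is possible only if the latter is also 1. *)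
Lemma descend_orth u a c v mu :
    descend (u ++ [:: a, c & v]) = Some mu -> a != c /\
  (A a c = 0 <-> descend (u ++ [:: c, a & v]) <> None).
Proof.
move=> opu; have [nu] := descend_cat opu; case/descend_cons=> nu1.
case/descend_cons => nu2 op2 [nu2c ->] [].
rewrite !mxE => nu2a _; have ac : a != c.
  by apply/eqP => e; move: nu2a; rewrite e nu2c Adiag.
split=> //; split=> [Aac|]; first by rewrite -(descend_catl u (descend_swap v Aac)) opu.
case E: (descend (u ++ _)) => [nu'|] // _.
have [nu5 /descend_cons[nu3 /descend_cons[nu4]]] := descend_cat E.
rewrite op2 => -[<-] [nu4a _] _.
by move: nu2a; rewrite nu4a; lia.
Qed.

(** The pairing with h_a runs through 1, -1 and 0, so the left [a] cannot be applied. *)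
Lemma descend_noniji u a c v mu :
  A a c = -1 -> descend (u ++ [:: a, c, a & v]) = Some mu -> False.
Proof.
move=> Aac /descend_cat[nu /descend_cons[nu1 /descend_cons[nu2]]].
case/descend_cons=> nu3 _ [nu3a ->] [_ ->] [].
by rewrite !mxE nu3a Adiag Aac.
Qed.

(** By induction on the word: [A j l = -1] for its first letter [l] would give pairing -2 before [l]
    is applied. So [l] is [j] or orthogonal to [j], and in the latter case the pairing was already
    -1. The empty word is excluded since [La] is dominant. *)
Lemma descend_to_front s mu j : descend s = Some mu -> mu 0 j = -1 ->
  exists2 s', exch A s (j :: s') & descend (j :: s') = Some mu.
Proof.
elim: s mu => [|l s IH] mu.
  by move=> [<-] Laj; move: (La_dom j); rewrite pairing_scoroot Laj.
move=> op; case/descend_cons: (op) => mu1 op1 [mu1l emu] muj.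
case: (altP (j =P l)) => [->|jl]; first by exists s => //; exact: exch_refl.
have mu1j : mu1 0 j = -1 + A j l by rewrite -muj emu !mxE; ring.
have Ajl : A j l = 0.
  case: (Aoff jl) => // Ajl; move: (descend_minuscule j op1).
  by rewrite mu1j Ajl.
have [s' es' _] := IH _ op1 (etrans mu1j (congr1 (+%R (-1)) Ajl)).
have e : exch A (l :: s) [:: j, l & s'].
  apply: (@exch_step _ _ _ [::]); last by rewrite Asym.
  exact: exch_cons.
by exists (l :: s') => //; rewrite -(descend_exch e).
Qed.

(** The first letter [j] of [s2] makes the final weight pair to -1 with h_j, so [s1] can be
    exchanged into a word starting with [j], and [j] is cancelled. *)
Lemma descend_connected s1 s2 mu : size s1 = size s2 ->
  descend s1 = Some mu -> descend s2 = Some mu -> exch A s1 s2.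
Proof.
elim: s2 s1 mu => [|j s2 IH] s1 mu.
  by case: s1 => // _ _ _; exact: exch_refl.
move=> sz op1 /descend_cons[mu2 op2 [mu2j emu]].
have muj : mu 0 j = -1 by rewrite emu !mxE mu2j Adiag.
have [s' es' /descend_cons[mu' op' [_ emu']]] := descend_to_front op1 muj.
apply: (exch_trans es'); apply/exch_cons/(IH _ _ _ _ op2).
  by move: sz; rewrite (exch_size es') => -[].
by rewrite op'; congr Some; move: emu'; rewrite emu => /addIr.
Qed.

(** A simple reflection of a weight with pairing 0, 1 or -1 fixes it, adds a letter in front, or
    removes a letter that has been moved to the front. *)
Lemma descend_orbit mu : weyl_orbit A La mu -> exists s, descend s = Some mu.
Proof.
case=> w ->; elim: w => [|j w [s op]] /=; first by exists [::].
set nu := foldr _ _ _ in op *; rewrite /reflw pairing_scoroot.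
have := descend_minuscule j op; rewrite !inE => /or3P[]/eqP nuj.
- by exists s; rewrite op nuj scale0r subr0.
- exists (j :: s); apply/descend_cons; exists nu => //.
  by rewrite nuj scale1r.
- have [s' _ /descend_cons[nu' op' [_ enu]]] := descend_to_front op nuj.
  by exists s'; rewrite op' nuj scaleN1r opprK [in RHS]enu subrK.
Qed.

End Descent.

(** * Nondegeneracy of the Cartan matrices *)

Section Cartan.

Lemma cartan_simply_laced (X : dynkin) : simply_laced (cartan X).
Proof.
split=> [j|j l|j l jl]; rewrite !mxE ?eqxx // 1?eq_sym 1?orbC //.
by rewrite eq_sym (negPf jl); case: ifP; [right | left].
Qed.

Lemma sum_ord_eq n (f : nat -> int) (c : nat) :
  \sum_(j < n) (if c == j then f j else 0) = if (c < n)%N then f c else 0.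
Proof.
rewrite -(big_mkord xpredT (fun j => if c == j then f j else 0)).
case: ltnP => cn; last first.
  by apply: big1_seq => j; rewrite mem_index_iota => /andP[_ jn]; case: eqP => // cj; lia.
have c_in : c \in index_iota 0 n by rewrite mem_index_iota.
rewrite (bigD1_seq c c_in (iota_uniq _ _)) /= eqxx big1 ?addr0 // => j.
by rewrite eq_sym => /negPf->.
Qed.

(** One row of a Cartan matrix applied to a vector: [a] is the diagonal entry and [s] lists the
    neighbours of node [i]. Since [f] vanishes from [n] on, a neighbour beyond the end of the
    diagram may be listed. *)
Lemma sum_row_support n (g : 'I_n -> int) (f : nat -> int) (a : int)
    (i : nat) (s : seq nat) :
  (forall j : 'I_n, g j = a * (if i == j then f j else 0)
                          - \sum_(c <- s) (if c == j then f j else 0)) ->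
  (forall j, (n <= j)%N -> f j = 0) ->
  \sum_(j < n) g j = a * f i - \sum_(c <- s) f c.
Proof.
move=> gE f0; rewrite (eq_bigr _ (fun j _ => gE j)) sumrB -mulr_sumr.
have fE c : (if (c < n)%N then f c else 0) = f c.
  by case: ltnP => // cn; rewrite f0.
rewrite sum_ord_eq fE exchange_big /=; congr (_ - _).
by apply: eq_bigr => c _; rewrite sum_ord_eq fE.
Qed.

(** A kernel vector has vanishing second differences along a chain, hence is an arithmetic
    progression there. *)
Lemma chain_arith (f : nat -> int) (p m : nat) :
  (forall k, (p < k < m)%N -> 2 * f k = f k.-1 + f k.+1) ->
  forall k, (p <= k <= m)%N -> f k = f p + (k - p)%:Z * (f p.+1 - f p).
Proof.
move=> fE k; elim/ltn_ind: k => k IH kpm.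
have [kp|[kp|[q kq]]] : k = p \/ k = p.+1 \/ exists q, k = q.+2 /\ (p < q.+1)%N.
- have [kp|kp] := leqP k p.+1; first by lia.
  by right; right; exists k.-2; lia.
- by rewrite kp subnn; ring.
- by rewrite kp subSnn; ring.
case: kq => kq pq; have := fE q.+1; rewrite pq kq /=.
have -> : (q.+1 < m)%N by lia.
move=> /(_ isT) e; have := IH q.+1; have := IH q; rewrite kq.
move=> /(_ _ _) IHq /(_ _ _) IHq1; rewrite IHq in e; try lia.
rewrite IHq1 in e; try lia.
have -> : f q.+2 = 2 * (f p + (q.+1 - p)%:Z * (f p.+1 - f p))
                   - (f p + (q - p)%:Z * (f p.+1 - f p)) by rewrite e; ring.
have -> : (q.+1 - p)%N%:Z = (q - p)%N%:Z + 1 by lia.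
have -> : (q.+2 - p)%N%:Z = (q - p)%N%:Z + 2 by lia.
ring.
Qed.

Section ExtendByZero.
Variables (n : nat) (z : 'I_n -> int).

Definition ext0 (j : nat) : int := oapp z 0 (insub j).

Lemma ext0E (j : 'I_n) : ext0 j = z j.
Proof. by rewrite /ext0 valK. Qed.

Lemma ext0_out j : (n <= j)%N -> ext0 j = 0.
Proof. by move=> nj; rewrite /ext0 insubF // ltnNge nj. Qed.

End ExtendByZero.

(** Padded by a zero at either end, a kernel vector is an arithmetic progression with two zeros. *)
Lemma cartanA_inj n (z : 'I_n -> int) :
  (forall i, \sum_j cartan (DynkinA n) i j * z j = 0) -> forall j, z j = 0.
Proof.
move=> z0 j; pose f k := if k is k'.+1 then ext0 z k' else 0.
have row (i : nat) : (i < n)%N -> 2 * f i.+1 = f i + f i.+2.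
  move=> ilt; have := z0 (Ordinal ilt).
  pose s := i.+1 :: (if i is i'.+1 then [:: i'] else [::]).
  rewrite (@sum_row_support _ _ (ext0 z) 2 i s); last first.
  - exact: ext0_out.
  - move=> l; rewrite mxE -val_eqE /= -[z l]ext0E !eqSS /s big_cons.
    by case: (i) => [|i'] /=; rewrite ?big_seq1 ?big_nil; do ?case: eqP => /= ?; try lia.
  rewrite /s big_cons; case: (i) => [|i'] /=; rewrite ?big_seq1 ?big_nil; lia.
have fk := @chain_arith f 0 n.+1 _.
have fE k : (k <= n.+1)%N -> f k = k%:Z * f 1%N.
  move=> kn; rewrite fk ?subn0 //= ?subr0 ?add0r //.
  by case=> // k' /andP[_ k'n]; exact: row.
have f1 : f 1%N = 0.
  by have := fE n.+1 (leqnn _); rewrite {1}/f ext0_out // => /esym/eqP;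
    rewrite mulf_eq0 => /orP[]// /eqP.
have := fE j.+1; rewrite /f ext0E ltnS (ltnW (ltn_ord j)) => -> //.
by rewrite -/(f 1%N) f1 mulr0.
Qed.

(** The rows of the two leaves and of the branch node give [f 3 = f 2], so a kernel vector is
    constant along the chain, and it is 0 just beyond its end. *)
Lemma cartanD_inj n (z : 'I_n -> int) : (4 <= n)%N ->
  (forall i, \sum_j cartan (DynkinD n) i j * z j = 0) -> forall j, z j = 0.
Proof.
move=> n4 z0 j; pose f := ext0 z.
pose nb (i : nat) : seq nat := match i with
    | 0 | 1 => [:: 2] | 2 => [:: 0; 1; 3] | i'.+1 => [:: i'; i'.+2]
    end%N.
have row (i : nat) : (i < n)%N -> 2 * f i = \sum_(c <- nb i) f c.
  move=> ilt; have := z0 (Ordinal ilt).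
  rewrite (@sum_row_support _ _ f 2 i (nb i)); first lia; last exact: ext0_out.
  move=> l; rewrite mxE -val_eqE /= -[z l]ext0E -/f.
  rewrite !inE !xpair_eqE /nb.
  by case: (i) => [|[|[|i']]] /=; rewrite !big_cons big_nil;
   case: (val l) => [|[|[|[|l']]]] //=;
   rewrite ?eqSS; do ?case: eqP => /= ?; try lia.
have r0 := row 0%N; have r1 := row 1%N; have r2 := row 2%N.
rewrite !big_cons !big_nil in r0 r1 r2.
have f23 : f 3%N = f 2%N by lia.
have fk : forall k, (2 <= k <= n)%N -> f k = f 2%N.
  move=> k kn; rewrite (@chain_arith f 2 n) ?f23 ?subrr ?mulr0 ?addr0 //.
  case=> [|[|[|k']]] // /andP[_ k'n]; rewrite row //.
  by rewrite !big_cons big_nil addr0.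
have f2 : f 2%N = 0 by rewrite -(fk n) ?n4 ?leqnn ?(ltnW (ltnW n4)) //; exact: ext0_out.
rewrite -ext0E -/f; have jn := ltn_ord j; move: (nat_of_ord j) jn => [|[|k]] kn; try lia.
by rewrite fk ?f2 //; lia.
Qed.

Lemma cartanE6_inj (z : 'I_6 -> int) :
  (forall i, \sum_j cartan DynkinE6 i j * z j = 0) -> forall j, z j = 0.
Proof.
move=> z0 j.
have row i (ilt : (i < 6)%N) := z0 (Ordinal ilt).
have := (row 0%N isT, row 1%N isT, row 2%N isT, row 3%N isT,
  row 4%N isT, row 5%N isT).
rewrite !big_ord_recl !big_ord0 !mxE /= -!ext0E /= /bump /= ?addn0 ?add1n.
move=> [[[[[]]]]]; case: j => [[|[|[|[|[|[|//]]]]]] _] /=; lia.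
Qed.

Lemma cartanE7_inj (z : 'I_7 -> int) :
  (forall i, \sum_j cartan DynkinE7 i j * z j = 0) -> forall j, z j = 0.
Proof.
move=> z0 j.
have row i (ilt : (i < 7)%N) := z0 (Ordinal ilt).
have := (row 0%N isT, row 1%N isT, row 2%N isT, row 3%N isT,
  row 4%N isT, row 5%N isT, row 6%N isT).
rewrite !big_ord_recl !big_ord0 !mxE /= -!ext0E /= /bump /= ?addn0 ?add1n.
move=> [[[[[[]]]]]]; case: j => [[|[|[|[|[|[|[|//]]]]]]] _] /=; lia.
Qed.

Lemma cartan_inj (X : dynkin) (z : 'I_(rank X) -> int) : dynkin_wf X ->
  (forall i, \sum_j cartan X i j * z j = 0) -> forall j, z j = 0.
Proof.
case: X z => [n|n||] z /=.
- by move=> _; exact: cartanA_inj.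
- exact: cartanD_inj.
- by move=> _; exact: cartanE6_inj.
- by move=> _; exact: cartanE7_inj.
Qed.

(** The entrywise difference lies in the kernel of the Cartan matrix. It follows that the weight
    reached by a word determines its content, hence its length. *)
Lemma weight_of_inj (X : dynkin) (beta gamma : posroot (rank X)) :
  dynkin_wf X -> weight_of (cartan X) beta = weight_of (cartan X) gamma ->
  beta = gamma.
Proof.
move=> wf e; apply/rowP => j; apply/eqP; rewrite -eqz_nat -subr_eq0; apply/eqP.
apply: (cartan_inj (z := fun j => (beta 0 j)%:Z - (gamma 0 j)%:Z) wf) => i.
have wE (be : posroot (rank X)) :
    weight_of (cartan X) be 0 i = \sum_j cartan X i j * (be 0 j)%:Z.
  rewrite /weight_of summxE; apply: eq_bigr => l _.
  by rewrite mulmxnE [in LHS]mxE -mulr_natr natz.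
have /rowP/(_ i) := e; rewrite !wE => e'.
by under eq_bigr => l _ do rewrite mulrBr; rewrite sumrB e' subrr.
Qed.

Lemma weight_of_count (X : dynkin) (s : seq 'I_(rank X)) :
  \sum_(j <- s) sroot (cartan X) j
  = weight_of (cartan X) (\sum_(j <- s) delta_mx 0 j : posroot _).
Proof.
elim: s => [|j s IH]; rewrite ?big_nil ?big_cons ?IH /weight_of.
  by rewrite big1 // => j _; rewrite mxE mulr0n.
under [RHS]eq_bigr => l _ do rewrite mxE mulrnDr.
rewrite big_split /=; congr (_ + _).
rewrite (bigD1 j) //= big1 ?addr0 => [|l lj]; rewrite mxE !eqxx ?mulr1n //=.
by rewrite (negPf lj) mulr0n.
Qed.

End Cartan.

(** * Vanishing and coherence in the cyclotomic algebra *)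

Section MinusculeHecke.
Variables (n : nat) (A : 'M[int]_n) (La : weight n).
Hypothesis (Asl : simply_laced A).
Hypotheses (La_dom : dominant La) (La_min : minuscule A La).
Variables (R : pzRingType) (E : seq 'I_n -> R) (X T : nat -> R).
(** For [A a b = -1], [c a b] and [c' a b] stand for the coefficients of u and v in Q_{a,b}(u,v),
    and [ci a b] inverts [c a b]. *)
Variables (c c' ci : 'I_n -> 'I_n -> R).

Local Notation descend := (descend A La).

(* The relations of the cyclotomic algebra for simply laced A, with E s = e(s)
   and crossings and dots indexed by natural numbers; E s = 0 for s of the
   wrong weight. *)
Record minuscule_hecke : Prop := MinusculeHecke {
  mh_EE : forall s, E s * E s = E s;
  mh_TE : forall u a b v, T (size u) * E (u ++ [:: a, b & v])
                          = E (u ++ [:: b, a & v]) * T (size u);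
  mh_T2_eq : forall u a v, T (size u) * T (size u) * E (u ++ [:: a, a & v]) = 0;
  mh_T2_orth : forall u a b v, A a b = 0 ->
    T (size u) * T (size u) * E (u ++ [:: a, b & v]) = E (u ++ [:: a, b & v]);
  mh_T2_adj : forall u a b v, A a b = -1 ->
    T (size u) * T (size u) * E (u ++ [:: a, b & v])
    = (c a b * X (size u) + c' a b * X (size u).+1) * E (u ++ [:: a, b & v]);
  mh_TX : forall u a b v, a != b ->
    T (size u) * X (size u).+1 * E (u ++ [:: a, b & v])
    = X (size u) * T (size u) * E (u ++ [:: a, b & v]);
  mh_TX_eq : forall u a v,
    (T (size u) * X (size u).+1 - X (size u) * T (size u)) * E (u ++ [:: a, a & v])
    = E (u ++ [:: a, a & v]);
  mh_TXp_eq : forall u a v,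
    (T (size u) * X (size u) - X (size u).+1 * T (size u)) * E (u ++ [:: a, a & v])
    = - E (u ++ [:: a, a & v]);
  mh_TT : forall l m, (l.+1 < m)%N -> T l * T m = T m * T l;
  mh_braid_adj : forall u a b v, A a b = -1 ->
    (T (size u).+1 * T (size u) * T (size u).+1
     - T (size u) * T (size u).+1 * T (size u)) * E (u ++ [:: a, b, a & v])
    = c a b * E (u ++ [:: a, b, a & v]);
  mh_braid : forall u a b d v, a != d ->
    T (size u).+1 * T (size u) * T (size u).+1 * E (u ++ [:: a, b, d & v])
    = T (size u) * T (size u).+1 * T (size u) * E (u ++ [:: a, b, d & v]);
  mh_ci : forall a b, A a b = -1 -> ci a b * c a b = 1;
  mh_cyc0 : forall u j, La 0 j = 0 -> E (rcons u j) = 0;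
  mh_cyc1 : forall u j, La 0 j = 1 -> X (size u) * E (rcons u j) = 0 }.

Hypothesis mh : minuscule_hecke.

Let Adiag j : A j j = 2. Proof. by case: Asl. Qed.
Let Asym j l : A j l = A l j. Proof. by case: Asl. Qed.
Let Aoff j l : j != l -> A j l = 0 \/ A j l = -1.
Proof. by case: Asl => _ _; exact. Qed.

Lemma mh_TE1 u a b d v : T (size u).+1 * E (u ++ [:: a, b, d & v])
                         = E (u ++ [:: a, d, b & v]) * T (size u).+1.
Proof.
by have := mh_TE mh (rcons u a) b d v; rewrite size_rcons !cat_rcons.
Qed.

(** Since tau^2 e = e for orthogonal neighbours, the idempotent of one order lies in the ideal
    generated by that of the other. *)
Lemma mh_TE_orth u a b v : A a b = 0 ->
  E (u ++ [:: a, b & v])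
  = T (size u) * E (u ++ [:: b, a & v]) * T (size u).
Proof.
move=> Aab; rewrite -{1}(mh_T2_orth mh) // -mulrA (mh_TE mh) mulrA.
by rewrite (mh_TE mh) -mulrA.
Qed.

Lemma idem_exch0 u s1 s2 : exch A s1 s2 -> E (u ++ s2) = 0 -> E (u ++ s1) = 0.
Proof.
elim=> // w a b v _ IH Aab E0; apply: IH.
by rewrite catA mh_TE_orth // -catA E0 mulr0 mul0r.
Qed.

Lemma idem_eq0_dot u a v :
  X (size u).+1 * E (u ++ [:: a, a & v]) = 0 -> E (u ++ [:: a, a & v]) = 0.
Proof.
set p := size u; set e := E _ => X0.
have Te : T p * e = e * T p by exact: (mh_TE mh).
have e1 : e = - (X p * T p * e).
  by rewrite -[LHS](mh_TX_eq mh) mulrBl -mulrA X0 mulr0 sub0r.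
have e2 : e = - (T p * X p * e).
  rewrite -[LHS]opprK -[X in - X](mh_TXp_eq mh) mulrBl -[X in _ - X]mulrA Te.
  by rewrite [X p.+1 * _]mulrA X0 mul0r subr0.
(* [e] is its own square; multiplying the two expressions puts [T p * T p * e], which is zero, in
   the middle. *)
have -> : e = X p * (T p * T p * e) * X p * e.
  rewrite -[LHS](mh_EE mh) -/e [X in X * _]e1 [X in _ * X]e2 mulrNN.
  by rewrite -!mulrA (mulrA e) -Te !mulrA.
by rewrite (mh_T2_eq mh) mulr0 !mul0r.
Qed.

(** The two triple products of the braid relation factor through e(aab) and e(baa), so their
    difference, a unit times e(aba), is zero. *)
Lemma idem_iji0 u a b v : A a b = -1 ->
  E (u ++ [:: a, a, b & v]) = 0 -> E (u ++ [:: b, a, a & v]) = 0 ->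
  E (u ++ [:: a, b, a & v]) = 0.
Proof.
move=> Aab E1 E2; have := mh_braid_adj mh u v Aab.
rewrite mulrBl -!mulrA mh_TE1 E1 (mh_TE mh) E2 !mul0r !mulr0 subr0.
move=> /(congr1 ( *%R (ci a b))).
by rewrite mulr0 mulrA (mh_ci mh) // mul1r => <-.
Qed.

(** The prefix [u] is arbitrary, so the induction hypothesis for shorter suffixes stays available
    after front letters have been moved into the prefix. Nothing is claimed about dots on the
    strands of [u]. *)
Lemma vanishing v u :
  (descend v = None -> E (u ++ v) = 0) /\
  (forall q, (size u <= q < size u + size v)%N -> X q * E (u ++ v) = 0).
Proof.
have [m] := ubnP (size v); elim: m v u => // m IH v u.
case: v => [|j v] /=; first by split=> // q; lia.
rewrite ltnS => vm.
have [IH0 IHX] := IH v (rcons u j) vm; rewrite size_rcons cat_rcons in IH0 IHX.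
(* The other dots lie on strands of the shorter suffix, with [j] moved into the prefix. *)
suff [H0 HX] : (descend (j :: v) = None -> E (u ++ j :: v) = 0) /\
               X (size u) * E (u ++ j :: v) = 0.
  split=> // q /andP[uq qv]; have [<- //|uq'] := eqVneq (size u) q.
  by apply: IHX; lia.
case Ev: (descend v) => [mu|]; last by rewrite IH0 // mulr0.
have op (nu : weight n) : nu 0 j = 1 -> descend v = Some nu ->
    descend (j :: v) <> None.
  move=> nuj opv; have [] : exists nu', descend (j :: v) = Some nu'.
    by exists (nu - sroot A j); apply/descend_cons; exists nu.
  by move=> nu' ->.
case: v => [|l v] in vm IH0 IHX Ev op *.
  (* For a one-letter suffix the cyclotomic relation applies; pairing -1 is excluded by
     dominance. *)
  rewrite cats1; case: Ev => emu.
  have := descend_minuscule La_min j (erefl (descend [::])).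
  rewrite !inE => /or3P[]/eqP Laj.
  - by rewrite (mh_cyc0 mh) // mulr0.
  - by split; [move=> /(op _ Laj); case | exact: (mh_cyc1 mh)].
  - by have := La_dom j; rewrite pairing_scoroot Laj.
have [mu' Ev' [mu'l emu]] := (descend_cons _ _ _ _ _).1 Ev.
case: (altP (j =P l)) => [jl|jl].
  rewrite -jl in IHX *; split=> [_|].
    by apply: idem_eq0_dot; apply: IHX => /=; lia.
  by rewrite idem_eq0_dot ?mulr0 //; apply: IHX => /=; lia.
have [IH0' IHX'] := IH (j :: v) (rcons u l) vm.
rewrite size_rcons cat_rcons in IH0' IHX'.
case: (Aoff jl) => Ajl.
  split=> [opN|].
    rewrite mh_TE_orth // IH0' ?mulr0 ?mul0r //.
    apply/eqP; move: opN; rewrite descend_swap //.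
    case E1: (descend (j :: v)) => [nu|] // opN.
    have [nu' Ev2 [nu'j enu]] := (descend_cons _ _ _ _ _).1 E1.
    move: Ev2; rewrite Ev' => -[enu']; subst nu'.
    (* The orthogonal [l] does not change the pairing with h_j, so [j] could also be applied after
       [l]. *)
    have : mu 0 j = 1 by rewrite emu !mxE Ajl subr0.
    by move=> /op /(_ Ev); rewrite descend_swap // opN.
  rewrite mh_TE_orth // !mulrA -(mh_TX mh) 1?eq_sym // -[T _ * _ * _]mulrA.
  by rewrite IHX' ?mulr0 ?mul0r //=; lia.
have muj : mu 0 j = mu' 0 j + 1 by rewrite emu !mxE Ajl; ring.
have muj2 := descend_minuscule La_min j Ev.
have mu'j2 := descend_minuscule La_min j Ev'.
(* Applying [j] right after [v] would need pairing 1 with h_j, and [l] in place of [j] would then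
   raise it to 2. *)
have Elj : E (u ++ [:: l, j & v]) = 0.
  apply: IH0'; case E1: (descend (j :: v)) => [nu|] //.
  have [nu' Ev2 [nu'j enu]] := (descend_cons _ _ _ _ _).1 E1.
  by move: Ev2 muj2; rewrite Ev' muj => -[->]; rewrite nu'j.
have X0 : X (size u) * E (u ++ [:: j, l & v]) = 0.
  have := mh_T2_adj mh u v Ajl; rewrite -mulrA (mh_TE mh) Elj mul0r mulr0.
  rewrite mulrDl -!mulrA (IHX (size u).+1) /=; last by lia.
  rewrite mulr0 addr0 => /esym/(congr1 ( *%R (ci j l))).
  by rewrite mulr0 !mulrA (mh_ci mh) // mul1r.
split=> // opN.
(* Of the two possible values 0 and -1, the value 0 would make the pairing 1 after [l], and
   [j :: l :: v] a path. *)
have mu'j : mu' 0 j = -1.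
  move: mu'j2 muj2; rewrite muj !inE => /or3P[]/eqP mu'jE; rewrite mu'jE // => _.
  by have /op/(_ Ev) : mu 0 j = 1 by rewrite muj mu'jE.
have [v' ev' /descend_cons[mu2 Ev2 [mu2j emu']]] :=
  descend_to_front Asl La_dom La_min Ev' mu'j.
have -> // : E (u ++ [:: j, l & v]) = 0.
have szv := exch_size ev'.
apply: (@idem_exch0 _ _ [:: j, l, j & v']).
  by do 2 apply: exch_cons.
(* The weight of [v'] pairs to 0 with h_l, so [l :: v'] is not a path; and [j] cannot be applied
   twice in a row. These facts give the two hypotheses of [idem_iji0]. *)
have mu2l : mu2 0 l = 0.
  by move: mu'l; rewrite emu' !mxE Asym Ajl opprK => /(canRL (addrK _)); rewrite subrr.
have szv' : ((size v').+2 < m)%N by move: vm; rewrite /= szv.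
apply: idem_iji0 => //.
  have [H _] := IH [:: j, l & v'] (rcons u j) szv'; rewrite cat_rcons in H.
  apply: H.
  case E1: (descend [:: j, l & v']) => [nu|] //.
  have [nu1 /descend_cons[nu2]] := (descend_cons _ _ _ _ _).1 E1.
  by rewrite Ev2 => -[<-]; rewrite mu2l => -[].
have [H _] := IH [:: j, j & v'] (rcons u l) szv'; rewrite cat_rcons in H.
apply: H.
case E1: (descend [:: j, j & v']) => [nu|] //.
have [nu1 /descend_cons[nu2]] := (descend_cons _ _ _ _ _).1 E1.
by rewrite Ev2 => -[<-] [_ ->] [] ; rewrite !mxE mu2j Adiag.
Qed.

(** * Words of exchanges depend only on their end points *)

Definition tword (w : seq nat) : R := \prod_(m <- w) T m.

Lemma tword_cons m w : tword (m :: w) = T m * tword w.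
Proof. by rewrite /tword big_cons. Qed.

Lemma tword_cat w1 w2 : tword (w1 ++ w2) = tword w1 * tword w2.
Proof. by rewrite /tword big_cat. Qed.

Lemma tword_comm m w : {in w, forall k, (k.+1 < m) || (m.+1 < k)}%N ->
  tword w * T m = T m * tword w.
Proof.
elim: w => [|k w IH] kP; first by rewrite /tword big_nil mul1r mulr1.
rewrite tword_cons -mulrA IH; last by move=> l lw; apply: kP; rewrite inE lw orbT.
rewrite !mulrA; congr (_ * _).
by have /orP[] := kP k (mem_head _ _) => km; rewrite (mh_TT mh km).
Qed.

(** The relation [exch] with its crossings recorded; the latest crossing is the leftmost letter, as
    in a product of operators. *)
Inductive orth_path (s : seq 'I_n) : seq nat -> seq 'I_n -> Prop :=
| orth_path0 : orth_path s [::] s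
| orth_pathS w u a b v : orth_path s w (u ++ [:: a, b & v]) -> A a b = 0 ->
    orth_path s (size u :: w) (u ++ [:: b, a & v]).

Lemma orth_path_TE s w t : orth_path s w t -> tword w * E s = E t * tword w.
Proof.
elim=> [|{}w u a b v _ IH _]; first by rewrite /tword big_nil mulr1 mul1r.
by rewrite tword_cons -mulrA IH !mulrA (mh_TE mh).
Qed.

(* Two sequences related by exchanges of orthogonal neighbours have the same
   entries from {a, b}, in the same order, whenever A a b <> 0. *)
Definition compat (s t : seq 'I_n) : Prop :=
  forall a b, A a b != 0 -> filter (pred2 a b) s = filter (pred2 a b) t.

Lemma compat_swap u a b v : A a b = 0 ->
  compat (u ++ [:: a, b & v]) (u ++ [:: b, a & v]).
Proof.
move=> Aab x y Axy; rewrite !filter_cat; congr (_ ++ _).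
have : ~~ (pred2 x y a && pred2 x y b).
  apply/negP => /andP[/orP[]/eqP ea /orP[]/eqP eb]; move: Axy Aab; rewrite ea eb.
  - by rewrite Adiag.
  - by move=> /eqP.
  - by rewrite Asym => /eqP.
  - by rewrite Adiag.
by rewrite /=; case: (_ || _) => //=; case: (_ || _).
Qed.

Lemma orth_path_compat s w t : orth_path s w t -> compat s t.
Proof.
elim=> // {}w u a b v _ IH Aab x y Axy.
by rewrite IH // (compat_swap u v Aab Axy).
Qed.

Lemma first_occurrence (j : 'I_n) s : j \in s ->
  exists s1 s2, s = s1 ++ j :: s2 /\ j \notin s1.
Proof.
move=> js; exists (take (index j s) s), (drop (index j s).+1 s); split.
  by rewrite -{1}(cat_take_drop (index j s) s) (drop_nth j) ?index_mem ?nth_index.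
by rewrite in_take ?ltnn // ltnW // index_mem.
Qed.

Lemma compat_mem s j t : compat s (j :: t) -> j \in s.
Proof.
move=> st; have : j \in filter (pred2 j j) s.
  by rewrite st ?Adiag //= eqxx mem_head.
by rewrite mem_filter => /andP[].
Qed.

(** A letter of [s1] not orthogonal to [j] would precede [j] on the left, whereas [j] comes first on
    the right. For a non-orthogonal pair containing [j], therefore, no entry of [s1] survives the
    filter, and [j] cancels from the front of both lists. *)
Lemma compat_cons s1 j s2 t : compat (s1 ++ j :: s2) (j :: t) -> j \notin s1 ->
  {in s1, forall a, A a j = 0} /\ compat (s1 ++ s2) t.
Proof.
move=> st js1.
have orth : {in s1, forall a, A a j = 0}.
  move=> a as1; apply/eqP/negPn/negP => /st; rewrite filter_cat /= eqxx orbT.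
  have : a \in filter (pred2 a j) s1 by rewrite mem_filter /= eqxx.
  case E1: (filter _ s1) => [|d r] // _ [dj _].
  have : d \in filter (pred2 a j) s1 by rewrite E1 mem_head.
  by rewrite mem_filter dj (negPf js1) andbF.
split=> // a b Aab; have := st _ _ Aab.
rewrite !filter_cat /=; case: ifP => [jab|_] // .
suff -> : filter (pred2 a b) s1 = [::] by case.
apply/eqP; rewrite -[_ == _]negbK -has_filter; apply/hasPn => d ds1 /=.
apply/negP => dab; have Adj := orth _ ds1.
have dj : d != j by apply: contraNneq js1 => <-.
case/orP: jab dab => /eqP ja /orP[] /eqP da.
- by rewrite da ja eqxx in dj.
- by move: Aab; rewrite -ja -da Asym Adj.
- by move: Aab; rewrite -ja -da Adj.
- by rewrite da ja eqxx in dj.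
Qed.

(** A sorting word from [s] to [t]: the first entry of [t] is bubbled from its first occurrence in
    [s] to position [p], then the rest is sorted from [p.+1] on. The bubbling acts first and is
    therefore the right factor. *)
Fixpoint canon (p : nat) (s t : seq 'I_n) : seq nat :=
  if t is j :: t' then canon p.+1 (rem j s) t' ++ iota p (index j s) else [::].

Lemma canon_cat p s1 j s2 t : j \notin s1 ->
  canon p (s1 ++ j :: s2) (j :: t) = canon p.+1 (s1 ++ s2) t ++ iota p (size s1).
Proof.
move=> js1 /=; rewrite index_cat (negPf js1) /= eqxx addn0; congr (canon _ _ _ ++ _).
by elim: s1 js1 => /= [|a s1 IH]; rewrite ?eqxx //
  inE negb_or eq_sym => /andP[/negPf-> /IH->].
Qed.

Lemma canon_cat1 p u b j v t : j \notin u -> j != b ->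
  canon p (u ++ [:: b, j & v]) (j :: t)
  = canon p.+1 (u ++ b :: v) t ++ iota p (size u) ++ [:: (p + size u)%N].
Proof.
move=> ju jb; rewrite -cat_rcons canon_cat ?cat_rcons; last first.
  by rewrite mem_rcons inE negb_or jb.
by rewrite size_rcons -[(size u).+1]addn1 iotaD.
Qed.

Arguments canon : simpl never.

Lemma bubble_TE p s1 j s2 :
  tword (iota (size p) (size s1)) * E (p ++ s1 ++ j :: s2)
  = E (p ++ j :: s1 ++ s2) * tword (iota (size p) (size s1)).
Proof.
elim: s1 p => [|a s1 IH] p /=; first by rewrite /tword big_nil mulr1 mul1r.
rewrite tword_cons -mulrA -(size_rcons p a) -cat_rcons IH cat_rcons !mulrA.
by rewrite (mh_TE mh).
Qed.

(** Absorption of one exchange into the sorting word, by induction on the target. Its first letter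
    [j] lies in [u], is [a], is [b], or lies in [v]; the respective reasons are far commutation,
    tau^2 = 1, equality of words, and the braid relation. *)
Lemma canon_step t p u a b v : A a b = 0 -> compat (u ++ [:: a, b & v]) t ->
  tword (canon (size p) (u ++ [:: b, a & v]) t) * T (size p + size u)
    * E (p ++ u ++ [:: a, b & v])
  = tword (canon (size p) (u ++ [:: a, b & v]) t) * E (p ++ u ++ [:: a, b & v]).
Proof.
move=> Aab; have ab : a != b by apply/eqP => e; move: Aab; rewrite e Adiag.
elim: t p u v => [|j t IH] p u v.
  move=> /(_ a a); rewrite Adiag filter_cat /= eqxx /= => /(_ isT).
  by case: (filter _ u).
move=> cst; have jin := compat_mem cst.
(* The exchange is moved through the bubbling [W], arriving as crossing [m'], and is then absorbed
   by the rest of the sorting word. *)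
have step C C' W m m' s s' : W * T m * E s = T m' * W * E s ->
    W * E s = E s' * W -> C' * T m' * E s' = C * E s' ->
    C' * W * T m * E s = C * W * E s.
  move=> WT WE IHs; rewrite -[C' * W * T m]mulrA -[C' * _ * _]mulrA WT.
  by rewrite -[T m' * W * _]mulrA WE !mulrA IHs -!mulrA WE.
have [ju|ju] := boolP (j \in u).
  have [u1 [u2 [eu ju1]]] := first_occurrence ju; subst u.
  rewrite -catA in cst; have [orth cst'] := compat_cons cst ju1.
  rewrite -!catA /= !canon_cat // !tword_cat.
  apply: (step _ _ _ _ (size (rcons p j) + size (u1 ++ u2))%N
            _ (rcons p j ++ u1 ++ u2 ++ [:: a, b & v])).
  - rewrite size_rcons !size_cat /= addSn -!addnS tword_comm // => k.
    by rewrite mem_iota; lia.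
  - by rewrite cat_rcons -bubble_TE.
  have := IH (rcons p j) (u1 ++ u2) v; rewrite size_rcons -!catA; exact.
(* If [j = a], bubbling [a] past [b] undoes the exchange. *)
have [ja|ja] := eqVneq j a.
  subst a; rewrite canon_cat1 // canon_cat // !tword_cat.
  rewrite [tword [:: _]]big_seq1 -!mulrA; do 2 congr (_ * _).
  by have := mh_T2_orth mh (p ++ u) v Aab; rewrite size_cat -catA -mulrA.
(* If [j = b], the exchange is the rightmost letter of the bubbling for the unexchanged sequence. *)
have [jb|jb] := eqVneq j b.
  subst b; rewrite canon_cat1 // canon_cat // !tword_cat.
  by rewrite [tword [:: _]]big_seq1 !mulrA.
have jv : j \in v.
  by move: jin; rewrite mem_cat (negPf ju) !inE (negPf ja) (negPf jb).
have [v1 [v2 [ev jv1]]] := first_occurrence jv; subst v.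
have ncat x y w : u ++ [:: x, y & v1 ++ w] = (u ++ [:: x, y & v1]) ++ w.
  by rewrite -catA.
have jnotin x y : j != x -> j != y -> j \notin u ++ [:: x, y & v1].
  by move=> jx jy; rewrite mem_cat !inE !negb_or ju jx jy jv1.
rewrite ncat in cst; have [orth cst'] := compat_cons cst (jnotin _ _ ja jb).
rewrite !ncat !canon_cat ?jnotin // !tword_cat.
have -> : size (u ++ [:: b, a & v1]) = size (u ++ [:: a, b & v1]).
  by rewrite !size_cat.
(* [j] passes both [a] and [b], so the exchange moves one position to the right; the braid relation
   has no error term because [a] and [j] differ. *)
apply: (step _ _ _ _ (size p + size u).+1
          _ (rcons p j ++ (u ++ [:: a, b & v1]) ++ v2)).
- have -> : iota (size p) (size (u ++ [:: a, b & v1]))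
      = iota (size p) (size u) ++ [:: size p + size u; (size p + size u).+1]%N
        ++ iota (size p + size u).+2 (size v1).
    by rewrite size_cat iotaD; congr (_ ++ _).
  rewrite !tword_cat 2!tword_cons [tword [::]]big_nil mulr1.
  set m := (size p + size u)%N; set W1 := tword _; set W2 := tword (iota m.+2 _).
  have bub : W2 * E (p ++ (u ++ [:: a, b & v1]) ++ j :: v2)
             = E ((p ++ u) ++ [:: a, b, j & v1 ++ v2]) * W2.
    have := bubble_TE (p ++ u ++ [:: a; b]) v1 j v2.
    by rewrite !size_cat /= addn2 addnS addnS -/m -!catA.
  have := mh_braid mh (p ++ u) b (v1 ++ v2) (d := j) (a := a).
  rewrite eq_sym ja size_cat -/m => /(_ isT) braid.
  have W2T : W2 * T m = T m * W2.
    by apply: tword_comm => k; rewrite mem_iota; lia.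
  have W1T : W1 * T m.+1 = T m.+1 * W1.
    by apply: tword_comm => k; rewrite mem_iota; lia.
  rewrite -!mulrA bub (mulrA W2) W2T -(mulrA (T m) W2) bub.
  rewrite !(mulrA _ _ W2) !mulrA -(mulrA W1) -(mulrA W1) -(mulrA W1) -braid.
  by rewrite !mulrA W1T.
- by rewrite cat_rcons -bubble_TE.
have := IH (rcons p j) u (v1 ++ v2); rewrite size_rcons !ncat addSn; apply.
exact: cst'.
Qed.

Lemma canon_orth_path s w s1 t : orth_path s w s1 -> compat s t ->
  tword (canon 0 s1 t) * tword w * E s = tword (canon 0 s t) * E s.
Proof.
move=> sw st; elim: sw => [|{}w u a b v sw IH Aab].
  by rewrite [tword [::]]big_nil mulr1.
rewrite tword_cons -mulrA -[_ * _ * E s]mulrA (orth_path_TE sw) !mulrA.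
have cst : compat (u ++ [:: a, b & v]) t.
  by move=> x y Axy; rewrite -(st _ _ Axy) (orth_path_compat sw Axy).
have := canon_step [::] Aab cst; rewrite !cat0s => ->.
by rewrite -mulrA -(orth_path_TE sw) mulrA.
Qed.

Lemma canonxx p s : canon p s s = [::].
Proof. by elim: s p => //= j s IH p; rewrite /canon /= eqxx -/canon IH. Qed.

(* Both words act as the canonical word of the end point, which bubbles its
   first entry to the front, then its second entry, and so on. *)
Lemma orth_path_unique s w w' t : orth_path s w t -> orth_path s w' t ->
  tword w * E s = tword w' * E s.
Proof.
move=> sw sw'; have cst := orth_path_compat sw.
have := canon_orth_path sw' cst; rewrite -(canon_orth_path sw cst).
by rewrite canonxx [tword [::]]big_nil !mul1r => ->.
Qed.

End MinusculeHecke.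

(** * Reduced words *)

Section ReducedWords.
Variables (N : nat).
Implicit Types (s y z : seq 'I_N.-1) (w : 'S_N) (m k : 'I_N.-1).

Lemma word_perm_cons m s : word_perm (m :: s) = (word_perm s * stransp m)%g.
Proof. by []. Qed.

Lemma word_perm_cat s1 s2 :
  word_perm (s1 ++ s2) = (word_perm s2 * word_perm s1)%g.
Proof.
elim: s1 => [|m s1 IH]; first by rewrite mulg1.
by rewrite cat_cons !word_perm_cons IH mulgA.
Qed.

(** Conjugation by [word_perm y] carries the transposition of [k] to that of [m], so the two letters
    cancel. *)
Lemma word_perm_delete x m y k z :
  word_perm y (lo k) = lo m -> word_perm y (hi k) = hi m ->
  word_perm (x ++ m :: y ++ k :: z) = word_perm (x ++ y ++ z).
Proof.
move=> ylo yhi; rewrite !word_perm_cat !word_perm_cons !word_perm_cat !word_perm_cons.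
congr (_ * _)%g; rewrite -!mulgA; congr (_ * _)%g.
rewrite !mulgA (conjgC (stransp k)) /stransp tpermJ ylo yhi -mulgA.
by rewrite tperm2 mulg1.
Qed.

(** Two strands whose order gets reversed must meet as neighbours at some letter, with [a] still on
    the left. *)
Lemma word_perm_crossing y (a b : 'I_N) :
  (a < b)%N -> (word_perm y b < word_perm y a)%N ->
  exists y1 k y2, [/\ y = y1 ++ k :: y2, word_perm y2 a = lo k
                    & word_perm y2 b = hi k].
Proof.
elim: y => [|m y IH] ab; first by rewrite !perm1 ltnNge ltnW.
rewrite word_perm_cons !permM => wba.
case: (ltngtP (word_perm y a) (word_perm y b)) => [lt_ab|gt_ab|/val_inj/perm_inj e].
- have [/andP[/eqP ya /eqP yb]|nab] :=
    boolP ((word_perm y a == lo m) && (word_perm y b == hi m)).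
    by exists [::], m, y.
  suff : (stransp m (word_perm y a) < stransp m (word_perm y b))%N.
    by move/ltnW; rewrite leqNgt wba.
  by apply: stransp_ltn => // -[ya yb]; rewrite ya yb !eqxx in nab.
- have [y1 [k [y2 [-> ya yb]]]] := IH ab gt_ab.
  by exists (m :: y1), k, y2.
- by rewrite e ltnn in ab.
Qed.

(* A pair of strands that crosses twice could be uncrossed by deleting two
   letters, so in a reduced word a crossing pair is inverted by w. *)
Lemma reduced_crossing w s1 m s2 (a b : 'I_N) :
  reduced_expression w (s1 ++ m :: s2) ->
  word_perm s2 a = lo m -> word_perm s2 b = hi m -> (a < b)%N /\ (w b < w a)%N.
Proof.
move=> [ws smin] sa sb.
(* Were the strands already reversed, they would have crossed in [s2]; deleting that crossing and
   [m] gives a shorter word. *)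
have ab : (a < b)%N.
  rewrite ltnNge; apply/negP => ba.
  have ltba : (b < a)%N.
    rewrite ltn_neqAle ba andbT; apply/eqP => /val_inj e.
    by move: sa; rewrite -e sb => /(congr1 val) /=; lia.
  have [|y1 [k [y2 [es2 yb ya]]]] := @word_perm_crossing s2 _ _ ltba.
    by rewrite sa sb /=.
  have lo1 : word_perm y1 (lo k) = lo m.
    by rewrite -sa es2 word_perm_cat word_perm_cons !permM ya /stransp tpermR.
  have hi1 : word_perm y1 (hi k) = hi m.
    by rewrite -sb es2 word_perm_cat word_perm_cons !permM yb /stransp tpermL.
  have := smin (s1 ++ y1 ++ y2).
  rewrite -(word_perm_delete _ _ lo1 hi1) -es2 => /(_ ws).
  by rewrite es2 !size_cat /= size_cat /=; lia.
split=> //; rewrite ltnNge; apply/negP => wab.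
have wE c : w c = word_perm s1 (stransp m (word_perm s2 c)).
  by rewrite -ws word_perm_cat word_perm_cons !permM.
have ltab : (w a < w b)%N.
  rewrite ltn_neqAle wab andbT; apply/eqP => /val_inj/perm_inj e.
  by rewrite e ltnn in ab.
(* The strands would cross again in [s1], and that crossing could be deleted together with [m]. *)
have [||y1 [k [y2 [es1 ya yb]]]] := @word_perm_crossing s1 (lo m) (hi m).
- by rewrite /=.
- by move: ltab; rewrite !wE sa sb /stransp tpermL tpermR.
have := smin (y1 ++ y2 ++ s2).
rewrite -(word_perm_delete _ _ ya yb) -[_ :: _ ++ _]cat_cons catA -es1 => /(_ ws).
by rewrite es1 !size_cat /=; lia.
Qed.

End ReducedWords.

(** * Sequences of fixed length as lists, and reduced words of exchange permutations *)

Section Codom.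
Variables (n N : nat).
Implicit Types (nu : Iseq n N).

Lemma size_codom_ord nu : size (codom nu) = N.
Proof. by rewrite size_codom card_ord. Qed.

Lemma nth_codom_ord (j0 : 'I_n) nu (l : 'I_N) : nth j0 (codom nu) l = nu l.
Proof. by rewrite (nth_map l) ?nth_ord_enum // size_enum_ord. Qed.

Lemma codom_inj : injective (fun nu => codom nu).
Proof.
move=> nu mu e; apply/ffunP => l.
by rewrite -(nth_codom_ord (nu l)) e nth_codom_ord.
Qed.

Lemma placeM (v w : 'S_N) nu : place (w * v)%g nu = place v (place w nu).
Proof. by apply/ffunP => l; rewrite !ffunE invMg permM. Qed.

Lemma place1 nu : place 1%g nu = nu.
Proof. by apply/ffunP => l; rewrite !ffunE invg1 perm1. Qed.

Lemma place_stransp_id m nu : place (stransp m) (place (stransp m) nu) = nu.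
Proof. by rewrite -placeM /stransp tperm2 place1. Qed.

Lemma place_stransp m nu l : place (stransp m) nu l = nu (stransp m l).
Proof. by rewrite ffunE /stransp tpermV. Qed.

Lemma codom_swap nu (m : 'I_N.-1) : exists u v,
  [/\ codom nu = u ++ [:: nu (lo m), nu (hi m) & v], size u = m
    & codom (place (stransp m) nu) = u ++ [:: nu (hi m), nu (lo m) & v]].
Proof.
pose j0 := nu (lo m); have szm : (m.+1 < size (codom nu))%N.
  by rewrite size_codom_ord; exact: (ltn_ord (hi m)).
have szt : size (take m (codom nu)) = m by rewrite size_takel //; lia.
have nuE : codom nu = take m (codom nu) ++ [:: nu (lo m), nu (hi m)
                                             & drop m.+2 (codom nu)].
  rewrite -{1}(cat_take_drop m (codom nu)) (drop_nth j0) ?(drop_nth j0 szm); last by lia.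
  by rewrite (nth_codom_ord _ _ (lo m)) (nth_codom_ord _ _ (hi m)).
exists (take m (codom nu)), (drop m.+2 (codom nu)); split=> //.
apply: (@eq_from_nth _ j0) => [|l]; rewrite size_codom_ord.
  by rewrite size_cat /= size_drop szt -[N in LHS](size_codom_ord nu); lia.
move=> lN; rewrite (nth_codom_ord _ _ (Ordinal lN)) place_stransp /stransp.
rewrite nth_cat szt.
case: tpermP => [e|e|/eqP nlo /eqP nhi].
- have -> : l = m by case: e.
  by rewrite ltnn subnn.
- have -> : l = m.+1 by case: e.
  by rewrite ltnNge leqnSn /= subSnn.
rewrite -val_eqE /= in nlo; rewrite -val_eqE /= in nhi.
rewrite -(nth_codom_ord j0) {1}nuE nth_cat szt /=; case: ltnP => // ml.
by have -> : (l - m)%N = (l - m).-2.+2 by lia.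
Qed.

Lemma codom_split nu u a b v : codom nu = u ++ [:: a, b & v] ->
  exists m : 'I_N.-1, [/\ m = size u :> nat, nu (lo m) = a, nu (hi m) = b
    & codom (place (stransp m) nu) = u ++ [:: b, a & v]].
Proof.
move=> e; have um : (size u < N.-1)%N.
  by have := size_codom_ord nu; rewrite e size_cat /=; lia.
pose m := Ordinal um; exists m.
have [u' [v' [e' szu ->]]] := codom_swap nu m.
move: e; rewrite e' => /eqP; rewrite eqseq_cat ?szu //.
by move=> /andP[/eqP-> /eqP[-> -> ->]].
Qed.

Variable A : 'M[int]_n.

(** Only orthogonal neighbours are exchanged, so strands with non-orthogonal labels never cross. *)
Lemma exchanges_orth mu nu w : exchanges A mu nu w -> nu = place w mu /\
  forall k l : 'I_N, (k < l)%N -> A (mu k) (mu l) <> 0 -> (w k < w l)%N.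
Proof.
elim=> [|{}nu {}w m _ [nuE wlt] Am0].
  by split=> [|k l kl _]; rewrite ?place1 // !perm1.
split=> [|k l kl Akl]; first by rewrite nuE placeM.
rewrite !permM; apply: stransp_ltn; first exact: wlt.
by move=> [wk wl]; apply: Akl; rewrite -Am0 -wk -wl nuE !ffunE !permK.
Qed.

Lemma exch_exchanges (mu : Iseq n N) s : exch A (codom mu) s ->
  exists (nu : Iseq n N) w, codom nu = s /\ exchanges A mu nu w.
Proof.
elim=> [|u a b v _ [nu [w [e ex]]] Aab].
  by exists mu, 1%g; split=> //; exact: exchanges0.
have [m [_ nua nub e']] := codom_split e.
exists (place (stransp m) nu), (w * stransp m)%g; split=> //.
by apply: exchangesS ex _; rewrite nua nub.
Qed.

Lemma reduced_orth_path (mu : Iseq n N) w s : reduced_expression w s ->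
  (forall k l : 'I_N, (k < l)%N -> A (mu k) (mu l) <> 0 -> (w k < w l)%N) ->
  orth_path A (codom mu) [seq val m | m <- s] (codom (place w mu)).
Proof.
move=> sred wlt.
(* The prefix [s1] stays in view because reducedness concerns the whole word [s]. *)
suff H s1 s2 : s = s1 ++ s2 ->
    orth_path A (codom mu) [seq val m | m <- s2] (codom (place (word_perm s2) mu)).
  by have := H [::] s erefl; have [-> _] := sred.
elim: s2 s1 => [|m s2 IH] s1 es; first by rewrite place1; exact: orth_path0.
rewrite word_perm_cons placeM; set nu := place (word_perm s2) mu.
have [u [v [e szu ->]]] := codom_swap nu m.
rewrite map_cons -[val m]szu; apply: orth_pathS; last first.
  rewrite es in sred; apply/eqP/negPn/negP => /eqP Anu.
  (* A letter between non-orthogonal neighbours would cross a pair that [w] inverts, against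
     [wlt]. *)
  have [] := reduced_crossing (a := (word_perm s2)^-1%g (lo m))
     (b := (word_perm s2)^-1%g (hi m)) sred (permKV _ _) (permKV _ _).
  move=> ab; rewrite ltnNge ltnW // wlt //.
  by move: Anu; rewrite !ffunE.
by rewrite -e; apply: (IH (rcons s1 m)); rewrite es cat_rcons.
Qed.

End Codom.

(** * The cyclotomic relations *)

Section Qevaluation.
Variables (k : fieldType) (n : nat) (A : 'M[int]_n) (d : 'I_n -> nat).
Variables (t : 'I_n -> 'I_n -> nat -> nat -> k).
Hypothesis (Asl : simply_laced A).
Hypothesis (d_sym : symmetrizer A d).
Hypothesis (Qp : Qparam A d t).

Local Notation Q := (Qpoly A d t).

Lemma sum_size_widen (R : nzRingType) (V : nmodType) (p : {poly R}) (B : nat)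
    (F : nat -> V) :
  (size p <= B)%N -> (forall q, p`_q = 0 -> F q = 0) ->
  \sum_(q < size p) F q = \sum_(q < B) F q.
Proof.
move=> pB F0; rewrite (big_ord_widen _ _ pB) big_mkcond /=.
by apply: eq_bigr => q _; case: ltnP => // /(nth_default 0)/F0->.
Qed.

(** The symmetrizing integers of [i] and [j] agree, so the support condition of Q_{i,j} becomes p +
    q = 1. The arbitrary [G] lets one computation serve both [eval2] and [divdiff]. *)
Lemma Qpoly_sum (F : lmodType k) (G : nat -> nat -> F) (i j : 'I_n) :
  A i j = -1 ->
  \sum_(q < size (Q i j)) \sum_(p < size (Q i j)`_q) (Q i j)`_q`_p *: G p q
  = t i j 1 0 *: G 1%N 0%N + t i j 0 1 *: G 0%N 1%N.
Proof.
have [Adiag _ _] := Asl; have [d_gt0 _ dA] := d_sym.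
move=> Aij; have ij : i != j by apply/eqP => e; move: Aij; rewrite e Adiag.
have dij : d i = d j.
  have [_ Asym _] := Asl; have := dA i j; rewrite -[A j i]Asym Aij; lia.
set B := `|2 * Defs.form A d i j|.+1.
have B2 : (2 < B)%N by rewrite /B /Defs.form Aij; have := d_gt0 i; lia.
have coefQ p q : (Q i j)`_q`_p
    = if (q < B)%N && (p < B)%N && (p + q == 1)%N then t i j p q else 0.
  rewrite /Qpoly -/B coef_poly; case: ltnP => qB; last by rewrite coef0.
  rewrite coef_poly; case: ltnP => //= pB; rewrite ij /= /Qsupp /Defs.form !Adiag Aij dij.
  congr (if _ then _ else _); have := d_gt0 j.
  by move=> dj; apply/idP/idP => /eqP h; apply/eqP; nia.
rewrite (@sum_size_widen _ _ (Q i j) B (fun q =>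
  \sum_(p < size (Q i j)`_q) (Q i j)`_q`_p *: G p q)) ?size_poly //; last first.
  move=> q Q0; rewrite big1 // => p _.
  have -> : (Q i j)`_q`_p = 0 by move: (nat_of_ord p) => r; rewrite Q0 coef0.
  by rewrite scale0r.
under eq_bigr => q _.
  rewrite (@sum_size_widen _ _ (Q i j)`_q B (fun p => (Q i j)`_q`_p *: G p q)).
  - under eq_bigr => p _ do rewrite coefQ ltn_ord ltn_ord /=.
    over.
  - by rewrite /Qpoly -/B coef_poly ltn_ord size_poly.
  - by move=> p ->; rewrite scale0r.
pose inner q := \sum_(p < B)
  (if (p + q == 1)%N then t i j p q else 0) *: G p q.
rewrite -/(\sum_(q < B) inner q).
have [B' eB] : exists B', B = B'.+2 by exists B.-2; lia.
have i0 : inner 0%N = t i j 1 0 *: G 1%N 0%N.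
  rewrite /inner eB 2!big_ord_recl big1 /= ?scale0r ?add0r ?addr0 //.
  by move=> p _; rewrite /bump /= ?add1n ?addn0 scale0r.
have i1 : inner 1%N = t i j 0 1 *: G 0%N 1%N.
  rewrite /inner eB big_ord_recl big1 /= ?addr0 //.
  by move=> p _; rewrite /bump /= ?add1n ?addn1 scale0r.
have i2 q : inner q.+2 = 0.
  by rewrite /inner big1 // => p _; rewrite !addnS scale0r.
by rewrite eB 2!big_ord_recl /= -[bump 0 0]/1%N i0 i1 big1 ?addr0 //.
Qed.

Variable F : algType k.
Implicit Types a b c : F.

Lemma eval2_adj i j a b : A i j = -1 ->
  eval2 (Q i j) a b = t i j 1 0 *: a + t i j 0 1 *: b.
Proof.
move=> Aij; rewrite /eval2 (Qpoly_sum (fun p q => a ^+ p * b ^+ q)) //.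
by rewrite !expr0 !expr1 mulr1 mul1r.
Qed.

Lemma divdiff_adj i j a b c : A i j = -1 ->
  divdiff (Q i j) a b c = (t i j 1 0)%:A.
Proof.
move=> Aij; rewrite /divdiff
  (Qpoly_sum (fun p q => (\sum_(r < p) a ^+ (p.-1 - r) * c ^+ r) * b ^+ q)) //.
by rewrite big_ord_recl !big_ord0 !expr0 !mulr1 addr0 mul0r scaler0 addr0.
Qed.

Lemma Qpoly_orth i j : A i j = 0 -> Q i j = 1.
Proof. by move=> Aij; case: Qp => _ _; apply; rewrite /Defs.form Aij mulr0. Qed.

Lemma eval2_orth i j a b : A i j = 0 -> eval2 (Q i j) a b = 1.
Proof.
move=> /Qpoly_orth->; rewrite /eval2 size_poly1 big_ord1 coef1 eqxx.
by rewrite size_poly1 big_ord1 coef1 eqxx scale1r !expr0 mulr1.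
Qed.

Lemma divdiff_orth i j a b c : A i j = 0 -> divdiff (Q i j) a b c = 0.
Proof.
move=> /Qpoly_orth->; rewrite /divdiff size_poly1 big_ord1 coef1 eqxx.
by rewrite size_poly1 big_ord1 big_ord0 mul0r scaler0.
Qed.

Lemma Qpoly_eq i : Q i i = 0.
Proof.
by apply/polyP => q; rewrite coef_poly coef0 eqxx; case: ltnP => // _;
  apply/polyP => p; rewrite coef_poly coef0; case: ltnP.
Qed.

Lemma eval2_eq i a b : eval2 (Q i i) a b = 0.
Proof. by rewrite Qpoly_eq /eval2 size_poly0 big_ord0. Qed.

Lemma divdiff_eq i a b c : divdiff (Q i i) a b c = 0.
Proof. by rewrite Qpoly_eq /divdiff size_poly0 big_ord0. Qed.

Lemma t_neq0 i j : A i j = -1 -> t i j 1 0 != 0.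
Proof.
move=> Aij; have [Adiag _ _] := Asl; have [_ + _] := Qp.
move=> /(_ i j); rewrite Aij; apply.
by apply/eqP => e; move: Aij; rewrite e Adiag.
Qed.

End Qevaluation.

(** * The cyclotomic algebra as an instance of [minuscule_hecke] *)

Section CyclotomicRelations.
Variables (k : fieldType) (n : nat) (A : 'M[int]_n) (d : 'I_n -> nat).
Variables (t : 'I_n -> 'I_n -> nat -> nat -> k) (beta : posroot n).
Variable (La : weight n).
Hypothesis (Asl : simply_laced A).
Hypothesis (d_sym : symmetrizer A d).
Hypothesis (Qp : Qparam A d t).

Local Notation N := (ht beta).
Local Notation I_N := (Iseq n N).
Local Notation F := (freeAlg k (qhgen beta)).
(* All products in the cyclotomic algebra are taken through this one instance:
   unification is very slow at comparing two instances of the quotient. *)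
Definition cyc_ring : pzRingType := cyclotomicQH A d t beta La.

Local Notation R := cyc_ring.
Local Notation e := (@gen_e k n beta).
Local Notation x := (@gen_x k n beta).
Local Notation tau := (@gen_tau k n beta).
Local Notation Q := (Qpoly A d t).

Definition cycl (a : F) : R := cycproj La (qproj (qhrel A d t (beta := beta)) a).

Lemma cyclM : {morph cycl : a b / a * b}.
Proof. by move=> a b; rewrite /cycl /cycproj !rmorphM. Qed.

Lemma cycl1 : cycl 1 = 1.
Proof. by rewrite /cycl /cycproj !rmorph1. Qed.

Lemma cyclD : {morph cycl : a b / a + b}.
Proof. by move=> a b; rewrite /cycl /cycproj !raddfD. Qed.

Lemma cyclB : {morph cycl : a b / a - b}.
Proof. by move=> a b; rewrite /cycl /cycproj !raddfB. Qed.

Lemma cyclN : {morph cycl : a / - a}.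
Proof. by move=> a; rewrite /cycl /cycproj !raddfN. Qed.

Lemma cycl0 : cycl 0 = 0.
Proof. by rewrite /cycl /cycproj !raddf0. Qed.

Lemma cycl_sum (I : Type) (r : seq I) (P : pred I) (f : I -> F) :
  cycl (\sum_(i <- r | P i) f i) = \sum_(i <- r | P i) cycl (f i).
Proof. by rewrite /cycl /cycproj !raddf_sum. Qed.

Lemma cyclA (c : k) : cycl c%:A = algin c.
Proof. by []. Qed.

Lemma cyclZ c a : cycl (c *: a) = c *: cycl a.
Proof. by rewrite -mulr_algl cyclM cyclA. Qed.

Lemma cycprojM (a b : quiverHecke A d t beta) :
  cycproj La (a * b) = cycproj La a * cycproj La b.
Proof. exact: rmorphM. Qed.

Lemma cycproj_prod (s : seq 'I_N.-1) (f : 'I_N.-1 -> quiverHecke A d t beta) :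
  cycproj La (\prod_(m <- s) f m) = \prod_(m <- s) cycproj La (f m).
Proof. exact: rmorph_prod. Qed.

Lemma cyc_scaleE (c : k) (r : R) :
  c *: (r : cyclotomicQH A d t beta La) = (algin c : R) * r.
Proof. by []. Qed.

Lemma cyc_scalerAr (c : k) (r r' : R) : r * (c *: r') = c *: (r * r').
Proof. by rewrite !cyc_scaleE !mulrA algin_central. Qed.

Lemma cyc_scalerAl (c : k) (r r' : R) : c *: r * r' = c *: (r * r').
Proof. by rewrite !cyc_scaleE mulrA. Qed.

Lemma cycl_surj (r : R) : exists a, r = cycl a.
Proof. by exists (qrepr (qrepr r)); rewrite /cycl /cycproj !qreprK. Qed.

Lemma cycl_rel a : qhrel A d t a -> cycl a = 0.
Proof.
move=> ra; rewrite /cycl (_ : qproj _ a = 0) /cycproj ?raddf0 //.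
by apply/qproj_eq0; rewrite -[a]mul1r -[1 * a]mulr1; exact: in_ideal_gen.
Qed.

Lemma cycl_cyc (l : 'I_N) (nu : I_N) : l.+1 = N -> nu \in Ibeta beta ->
  cycl (x l ^+ `|La 0 (nu l)| * e nu) = 0.
Proof.
move=> lN nuI; rewrite /cycl rmorphM rmorphXn; apply/qproj_eq0.
rewrite -[in_ideal _ _]/(in_ideal _ (qh_x A d t l ^+ _ * qh_e A d t nu)).
rewrite -[X in in_ideal _ X]mul1r -[X in in_ideal _ X]mulr1.
by apply: in_ideal_gen; rewrite -pairing_scoroot; exact: CycRel.
Qed.

Lemma gen_e_notin (nu : I_N) : nu \notin Ibeta beta -> e nu = 0.
Proof. by move=> nuI; rewrite /gen_e insubF // (negPf nuI). Qed.

Lemma Ibeta_stransp (m : 'I_N.-1) (nu : I_N) :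
  (place (stransp m) nu \in Ibeta beta) = (nu \in Ibeta beta).
Proof.
rewrite !inE; congr (_ == _); rewrite (reindex_inj (@perm_inj _ (stransp m))).
by apply: eq_bigr => l _; rewrite place_stransp /stransp tpermK.
Qed.

(** Idempotents, dots and crossings are extended by zero to all lists and natural numbers, so that
    relations about concatenations carry no length or bound conditions. *)
Definition Eseq (s : seq 'I_n) : R :=
  if [pick nu : I_N | codom nu == s] is Some nu then cycl (e nu) else 0.
Definition Xnat (l : nat) : R := if insub l is Some l' then cycl (x l') else 0.
Definition Tnat (m : nat) : R := if insub m is Some m' then cycl (tau m') else 0.

Lemma Eseq_codom (nu : I_N) : Eseq (codom nu) = cycl (e nu).
Proof.
rewrite /Eseq; case: pickP => [mu /eqP/codom_inj-> //|/(_ nu)].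
by rewrite eqxx.
Qed.

Lemma Eseq_neq0 s : Eseq s <> 0 ->
  exists nu : I_N, [/\ codom nu = s, nu \in Ibeta beta & Eseq s = cycl (e nu)].
Proof.
move=> Es; have [nu es] : exists nu : I_N, codom nu = s.
  by move: Es; rewrite /Eseq; case: pickP => // nu /eqP <- _; exists nu.
exists nu; split=> //; last by rewrite -es Eseq_codom.
have [//|nuI] := boolP (nu \in _).
by case: Es; rewrite -es Eseq_codom gen_e_notin // cycl0.
Qed.

Lemma Xnat_val (l : 'I_N) : Xnat l = cycl (x l).
Proof. by rewrite /Xnat valK. Qed.

Lemma Tnat_val (m : 'I_N.-1) : Tnat m = cycl (tau m).
Proof. by rewrite /Tnat valK. Qed.

Lemma Tnat_case m :
  Tnat m = 0 \/ exists2 m' : 'I_N.-1, m = m' & Tnat m = cycl (tau m').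
Proof.
by rewrite /Tnat; case: insubP => [m' _ em|_]; [right; exists m' | left].
Qed.

(** A relation multiplied by an idempotent has to be checked at 0 and at genuine sequences of I^beta
    only, the latter with the crossing [m] at position [size u]. *)
Lemma Eseq_ind u a b v (P : R -> Prop) : P 0 ->
  (forall (nu : I_N) (m : 'I_N.-1), nu \in Ibeta beta ->
     m = size u :> nat -> nu (lo m) = a -> nu (hi m) = b ->
     codom nu = u ++ [:: a, b & v] ->
     codom (place (stransp m) nu) = u ++ [:: b, a & v] -> P (cycl (e nu))) ->
  P (Eseq (u ++ [:: a, b & v])).
Proof.
move=> P0 PE; have [->//|/eqP/Eseq_neq0[nu [es nuI ->]]] :=
  eqVneq (Eseq (u ++ [:: a, b & v])) 0.
by have [m [mu nua nub es']] := codom_split es; exact: PE es'.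
Qed.

Lemma cycl_eq a b : qhrel A d t (a - b) -> cycl a = cycl b.
Proof. by move/cycl_rel; rewrite cyclB => /eqP; rewrite subr_eq0 => /eqP. Qed.

Lemma cyclM3 a b c : cycl (a * b * c) = cycl a * cycl b * cycl c.
Proof. exact: etrans (cyclM _ _) (congr1 ( *%R^~ _) (cyclM _ _)). Qed.

Lemma cyclB2 a b c d' f : cycl ((a * b - c * d') * f)
  = (cycl a * cycl b - cycl c * cycl d') * cycl f.
Proof.
apply: (etrans (cyclM _ _)); congr (_ * _); apply: (etrans (cyclB _ _)).
exact: (congr2 (fun u v => u - v) (cyclM _ _) (cyclM _ _)).
Qed.

Lemma cyclB3 a b c a' b' c' f : cycl ((a * b * c - a' * b' * c') * f)
  = (cycl a * cycl b * cycl c - cycl a' * cycl b' * cycl c') * cycl f.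
Proof.
apply: (etrans (cyclM _ _)); congr (_ * _); apply: (etrans (cyclB _ _)).
exact: (congr2 (fun u v => u - v) (cyclM3 _ _ _) (cyclM3 _ _ _)).
Qed.

Lemma cycl_lin (c c' : k) a b f : cycl ((c *: a + c' *: b) * f)
  = (algin c * cycl a + algin c' * cycl b) * cycl f.
Proof.
apply: (etrans (cyclM _ _)); congr (_ * _); apply: (etrans (cyclD _ _)).
exact: (congr2 +%R (cyclZ _ _) (cyclZ _ _)).
Qed.

Lemma mulBl_eq0 (S : pzRingType) (a b c : S) : (a - b) * c = 0 -> a * c = b * c.
Proof. by rewrite mulrBl => /eqP; rewrite subr_eq0 => /eqP. Qed.

Lemma cycl_minuscule : dominant La ->
  minuscule_hecke A La Eseq Xnat Tnat
    (fun a b => algin (t a b 1 0)) (fun a b => algin (t a b 0 1))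
    (fun a b => algin (t a b 1 0)^-1).
Proof.
move=> La_dom; have [Adiag Asym _] := Asl; split.
- move=> s; have [->|/eqP/Eseq_neq0[nu [_ nuI ->]]] := eqVneq (Eseq s) 0.
    by rewrite mulr0.
  rewrite -cyclM; apply: cycl_eq.
  have := @qhrel_ee _ _ A d t _ _ _ nuI nuI; rewrite eqxx; exact.
- move=> u a b v; have [E0|/eqP/Eseq_neq0[nu [es nuI ->]]] :=
    eqVneq (Eseq (u ++ [:: a, b & v])) 0.
    rewrite E0 mulr0; have [->|/eqP/Eseq_neq0[mu [es muI Emu]]] :=
      eqVneq (Eseq (u ++ [:: b, a & v])) 0; first by rewrite mul0r.
    (* With e(..ab..) zero, the relation for the swapped sequence shows that the right-hand side
       vanishes too. *)
    have [m [mu_m mua mub es']] := codom_split es.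
    have TE : cycl (tau m) * cycl (e (place (stransp m) mu))
              = cycl (e mu) * cycl (tau m).
      rewrite -!cyclM; apply: cycl_eq.
      have := @qhrel_te _ _ A d t _ m (place (stransp m) mu).
      by rewrite Ibeta_stransp place_stransp_id => /(_ muI).
    rewrite Emu -mu_m Tnat_val -TE -(Eseq_codom (place _ mu)).
    by rewrite es' E0 mulr0.
  have [m [nu_m nua nub es']] := codom_split es.
  rewrite -es' Eseq_codom -nu_m Tnat_val -!cyclM.
  by apply: cycl_eq; exact: qhrel_te.
- move=> u a v.
  apply: (Eseq_ind (P := fun r => _ * _ * r = 0)) => [|nu m nuI <- nua nub _ _].
    exact: mulr0.
  have H := cycl_eq (@qhrel_t2 _ _ A d t _ m _ nuI).
  rewrite Tnat_val -(cyclM3 (tau m) (tau m) (e nu)); apply: (etrans H).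
  by rewrite nua nub eval2_eq (mul0r (e nu)) cycl0.
- move=> u a b v Aab.
  apply: (Eseq_ind (P := fun r => _ * _ * r = r)) => [|nu m nuI <- nua nub _ _].
    exact: mulr0.
  have H := cycl_eq (@qhrel_t2 _ _ A d t _ m _ nuI).
  rewrite Tnat_val -(cyclM3 (tau m) (tau m) (e nu)); apply: (etrans H).
  by rewrite nua nub (eval2_orth Qp _ _ Aab) (mul1r (e nu)).
- move=> u a b v Aab.
  apply: (Eseq_ind (P := fun r => _ * r = _ * r)) => [|nu m nuI mu nua nub _ _].
    exact: etrans (mulr0 _) (esym (mulr0 _)).
  have H := cycl_eq (@qhrel_t2 _ _ A d t _ m _ nuI).
  rewrite -mu Tnat_val (Xnat_val (lo m)) (Xnat_val (hi m)).
  rewrite -(cyclM3 (tau m) (tau m) (e nu)); apply: (etrans H).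
  rewrite nua nub (eval2_adj t Asl d_sym _ _ Aab); exact: cycl_lin.
- move=> u a b v ab.
  apply: (Eseq_ind (P := fun r => _ * r = _ * r)) => [|nu m nuI mu nua nub _ _].
    exact: etrans (mulr0 _) (esym (mulr0 _)).
  have H := cycl_eq (@qhrel_tx _ _ A d t _ m (hi m) _ nuI).
  rewrite nua nub (negPf ab) !andbF /stransp tpermR cycl0 in H.
  rewrite -mu Tnat_val (Xnat_val (lo m)) (Xnat_val (hi m)).
  by apply: mulBl_eq0; rewrite -cyclB2.
- move=> u a v.
  apply: (Eseq_ind (P := fun r => _ * r = r)) => [|nu m nuI mu nua nub _ _].
    exact: mulr0.
  have H := cycl_eq (@qhrel_tx _ _ A d t _ m (hi m) _ nuI).
  have hilo : (hi m == lo m) = false by rewrite -val_eqE /=; apply/eqP; lia.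
  rewrite nua nub hilo !eqxx andFb andbT /stransp tpermR in H.
  rewrite -mu Tnat_val (Xnat_val (lo m)) (Xnat_val (hi m)).
  by rewrite -cyclB2.
- move=> u a v.
  apply: (Eseq_ind (P := fun r => _ * r = - r)) => [|nu m nuI mu nua nub _ _].
    by rewrite oppr0; exact: mulr0.
  have H := cycl_eq (@qhrel_tx _ _ A d t _ m (lo m) _ nuI).
  rewrite nua nub !eqxx andbT /stransp tpermL in H.
  rewrite -mu Tnat_val (Xnat_val (lo m)) (Xnat_val (hi m)).
  by rewrite -cyclB2 -cyclN.
- move=> l m lm; have [->|[l' el ->]] := Tnat_case l.
    exact: etrans (mul0r _) (esym (mulr0 _)).
  have [->|[m' em ->]] := Tnat_case m.
    exact: etrans (mulr0 _) (esym (mul0r _)).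
  rewrite -(cyclM (tau l')) -(cyclM (tau m')); apply: cycl_eq; apply: qhrel_tt.
  by rewrite -el -em lm.
- move=> u a b v Aab; have ab : a != b by apply/eqP => ab; move: Aab; rewrite ab Adiag.
  apply: (Eseq_ind (P := fun r => _ * r = _ * r)) => [|nu m nuI mu nua nub es _].
    exact: etrans (mulr0 _) (esym (mulr0 _)).
  rewrite -cat_rcons in es; have [m' [m'u nub' nua' _]] := codom_split es.
  rewrite size_rcons in m'u; have m'm : m' = m.+1 :> nat by rewrite mu.
  have H := cycl_eq (@qhrel_braid _ _ A d t _ m m' _ m'm nuI).
  rewrite nua nub nua' eqxx (divdiff_adj t Asl d_sym _ _ _ Aab) in H.
  rewrite -mu -m'm !Tnat_val -cyclB3; apply: (etrans H).
  exact: cyclM.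
- move=> u a b c v ac.
  apply: (Eseq_ind (P := fun r => _ * r = _ * r)) => [|nu m nuI mu nua nub es _].
    exact: etrans (mulr0 _) (esym (mulr0 _)).
  rewrite -cat_rcons in es; have [m' [m'u nub' nuc' _]] := codom_split es.
  rewrite size_rcons in m'u; have m'm : m' = m.+1 :> nat by rewrite mu.
  have H := cycl_eq (@qhrel_braid _ _ A d t _ m m' _ m'm nuI).
  rewrite nua nuc' (negPf ac) cycl0 in H.
  by rewrite -mu -m'm !Tnat_val; apply: mulBl_eq0; rewrite -cyclB3.
- by move=> a b Aab; rewrite -rmorphM mulVf ?rmorph1 // (t_neq0 Asl Qp).
- move=> u j Laj; have [//|/eqP/Eseq_neq0[nu [es nuI ->]]] := eqVneq (Eseq (rcons u j)) 0.
  have szu : size u = N.-1 by have := size_codom_ord nu; rewrite es size_rcons => <-.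
  have N0 : (0 < N)%N by have := size_codom_ord nu; rewrite es size_rcons => <-.
  pose l : 'I_N := Ordinal (etrans (congr1 (leq^~ N) (prednK N0)) (leqnn N)).
  have lN : l.+1 = N by rewrite /= prednK.
  have nul : nu l = j.
    by rewrite -(nth_codom_ord j) es nth_rcons szu /= ltnn eqxx.
  by have := cycl_cyc lN nuI; rewrite nul Laj expr0 (mul1r (e nu)).
- move=> u j Laj; have [->|/eqP/Eseq_neq0[nu [es nuI ->]]] := eqVneq (Eseq (rcons u j)) 0.
    by rewrite mulr0.
  have szu : size u = N.-1 by have := size_codom_ord nu; rewrite es size_rcons => <-.
  have N0 : (0 < N)%N by have := size_codom_ord nu; rewrite es size_rcons => <-.
  pose l : 'I_N := Ordinal (etrans (congr1 (leq^~ N) (prednK N0)) (leqnn N)).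
  have lN : l.+1 = N by rewrite /= prednK.
  have nul : nu l = j.
    by rewrite -(nth_codom_ord j) es nth_rcons szu /= ltnn eqxx.
  have H := cycl_cyc lN nuI; rewrite nul Laj in H.
  by rewrite szu (Xnat_val l) -(cyclM (x l) (e nu)); exact: H.
Qed.

End CyclotomicRelations.

(** * The module of paths *)

Section ModuleTheory.
Variables (k : comNzRingType) (A : pzAlgType k) (V : lmodType k).
Variable act : A -> V -> V.
Hypothesis act_mod : is_module act.

Lemma mact1 v : act 1 v = v.
Proof. by case: act_mod. Qed.
Lemma mactM a b v : act (a * b) v = act a (act b v).
Proof. by case: act_mod. Qed.
Lemma mactDl a b v : act (a + b) v = act a v + act b v.
Proof. by case: act_mod. Qed.
Lemma mactDr a u v : act a (u + v) = act a u + act a v.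
Proof. by case: act_mod. Qed.
Lemma mact_algin c v : act (algin c) v = c *: v.
Proof. by case: act_mod. Qed.
Lemma mact0l v : act 0 v = 0.
Proof. by apply: (addrI (act 0 v)); rewrite -mactDl !addr0. Qed.
Lemma mact0r a : act a 0 = 0.
Proof. by apply: (addrI (act a 0)); rewrite -mactDr !addr0. Qed.
Lemma mactNl a v : act (- a) v = - act a v.
Proof. by apply: (addrI (act a v)); rewrite -mactDl !subrr mact0l. Qed.
Lemma mactBl a b v : act (a - b) v = act a v - act b v.
Proof. by rewrite mactDl mactNl. Qed.
Lemma mact_sum (I : Type) (r : seq I) (P : pred I) (f : I -> A) v :
  act (\sum_(i <- r | P i) f i) v = \sum_(i <- r | P i) act (f i) v.
Proof. exact: (big_morph (act^~ v) (fun a b => mactDl a b v) (mact0l v)). Qed.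
Variable G : A -> Prop.
Hypothesis act_G : forall g v, G g -> act g v = 0.

(** The quotient acts through representatives; this is well defined because the ideal acts by zero
    as soon as its generators do. *)
Lemma quotAlg_action : exists qact : quotAlg G -> V -> V,
  is_module qact /\ forall a v, qact (qproj G a) v = act a v.
Proof.
pose qact (q : quotAlg G) v := act (qrepr q) v.
have act_ideal a v : in_ideal G a -> act a v = 0.
  elim=> [|a1 a2 _ IH1 _ IH2|a1 g a2 Gg].
  - exact: mact0l.
  - by rewrite mactDl IH1 IH2 addr0.
  - by rewrite !mactM (act_G _ Gg) mact0r.
have qactE a v : qact (qproj G a) v = act a v.
  apply/eqP; rewrite -subr_eq0 -mactBl act_ideal //.
  exact: qrepr_proj.
exists qact; split=> //; split.
- by move=> v; rewrite -[1]/(qproj G 1) qactE mact1.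
- by move=> p q v; rewrite -(qreprK p) -(qreprK q) -rmorphM !qactE mactM.
- by move=> p q v; rewrite -(qreprK p) -(qreprK q) -raddfD !qactE mactDl.
- by move=> q u v; exact: mactDr.
- by move=> c v; rewrite -[algin c]/(qproj G (algin c)) qactE mact_algin.
Qed.

End ModuleTheory.

Section FreeAction.
Variables (k : comNzRingType) (X : choiceType) (V : lmodType k).
Variable g : X -> V -> V.
Hypotheses (gD : forall x u v, g x (u + v) = g x u + g x v)
  (gZ : forall x c v, g x (c *: v) = c *: g x v).

(** Universal property of the free algebra: a monomial acts by its letters, the leftmost last. *)
Lemma freeAlg_action : exists act : freeAlg k X -> V -> V,
  is_module act /\ forall x v, act (fgen k x) v = g x v.
Proof.
pose wact (m : {fmonom X}) v := foldr g v (m : seq X).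
have wactD m u v : wact m (u + v) = wact m u + wact m v.
  by rewrite /wact; elim: (m : seq X) => //= x s ->; exact: gD.
have wactZ m c v : wact m (c *: v) = c *: wact m v.
  by rewrite /wact; elim: (m : seq X) => //= x s ->; exact: gZ.
have wact0 m : wact m 0 = 0.
  by apply: (addrI (wact m 0)); rewrite -wactD !addr0.
pose act (a : freeAlg k X) v := \sum_(m <- msupp a) a@_m *: wact m v.
have actEw (D : {fset {fmonom X}}) (a : freeAlg k X) v : (msupp a `<=` D)%fset ->
    act a v = \sum_(m <- D) a@_m *: wact m v.
  move=> aD; rewrite /act; apply: big_fset_incl => // m _ /mcoeff_outdom->.
  by rewrite scale0r.
have actU c m v : act (mkmalgU m c) v = c *: wact m v.
  by rewrite (actEw _ _ _ msuppU_le) big_seq_fset1 mcoeffUU.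
have actDl a b v : act (a + b) v = act a v + act b v.
  pose D := (msupp a `|` msupp b)%fset.
  rewrite (actEw D a) ?fsubsetUl // (actEw D b) ?fsubsetUr //.
  rewrite (actEw D) ?msuppD_le // -big_split /=.
  by apply: eq_bigr => m _; rewrite mcoeffD scalerDl.
have actDr a u v : act a (u + v) = act a u + act a v.
  by rewrite -big_split; apply: eq_bigr => m _; rewrite wactD scalerDr.
have act0l v : act 0 v = 0 by rewrite /act msupp0 big_seq_fset0.
have act_sum (I : Type) (r : seq I) (f : I -> freeAlg k X) v :
    act (\sum_(i <- r) f i) v = \sum_(i <- r) act (f i) v.
  exact: (big_morph (act^~ v) (fun a b => actDl a b v) (act0l v)).
have one_U : (1 : freeAlg k X) = mkmalgU (mone : {fmonom X}) 1.
  by rewrite -[LHS]mpolyC1E.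
exists act; split; last first.
  by move=> x v; rewrite /fgen actU scale1r /wact fmU.
split=> //.
- by move=> v; rewrite one_U actU scale1r /wact fm1.
- move=> a b v; rewrite malgME act_sum; apply: eq_bigr => m1 _.
  have wact_sum (r : seq {fmonom X}) (f : {fmonom X} -> V) :
      wact m1 (\sum_(i <- r) f i) = \sum_(i <- r) wact m1 (f i).
    exact: (big_morph (wact m1) (wactD m1) (wact0 m1)).
  rewrite act_sum wact_sum scaler_sumr; apply: eq_bigr => m2 _.
  by rewrite actU wactZ scalerA /wact fmM foldr_cat.
- move=> c v; rewrite -[algin c]/(c *: 1) one_U.
  rewrite (_ : c *: mkmalgU (mone : {fmonom X}) 1 = mkmalgU mone c); last first.
    by apply/malgP => m; rewrite mcoeffZ !mcoeffU mulrnAr mulr1.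
  by rewrite actU /wact fm1.
Qed.

End FreeAction.

Lemma freeAlg_ind (k : comNzRingType) (X : choiceType)
    (P : freeAlg k X -> Prop) :
  P 0 -> P 1 -> (forall a b, P a -> P b -> P (a + b)) ->
  (forall c a, P a -> P (c *: a)) ->
  (forall x a, P a -> P (fgen k x * a)) -> forall a, P a.
Proof.
move=> P0 P1 PD PZ PM a; rewrite [a]monalgE; elim/big_ind: _ => // m _.
have -> : << a@_m *g m >> = a@_m *: << 1 *g m >>.
  by apply/malgP => m'; rewrite mcoeffZ !mcoeffU mulrnAr mulr1.
apply: PZ; rewrite -[m]fmK; elim: (m : seq X) => [|x s IH].
  by rewrite -fmoneE -[<< _ *g _ >>]/(fgone _ _) in P1 *.
have -> : << 1 *g FMonom (x :: s) >> = fgen k x * << 1 *g FMonom s >>.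
  rewrite /fgen malgM_def fgmulUU mulr1; congr (<< _ *g _ >>).
  by apply/eqP; rewrite fmP fmM fmU.
exact: PM.
Qed.

(** * The operators on S(b) and the defining relations *)

Section PathModule.
Variables (k : fieldType) (n : nat) (A : 'M[int]_n) (d : 'I_n -> nat).
Variables (t : 'I_n -> 'I_n -> nat -> nat -> k) (La b : weight n).
Variable beta : posroot n.
Hypothesis (Asl : simply_laced A).
Hypothesis (d_sym : symmetrizer A d).
Hypothesis (Qp : Qparam A d t).
Hypotheses (La_dom : dominant La) (La_min : minuscule A La).

Local Notation N := (ht beta).
Local Notation I_N := (Iseq n N).
Local Notation P := (paths A La b N).
Local Notation pathType := (pathType A La b beta).
Local Notation V := (Smod k A La b beta).
Local Notation Q := (Qpoly A d t).
Implicit Types (nu mu : I_N) (v : V) (l m : 'I_N.-1).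

Hypothesis P_Ibeta : {subset P <= Ibeta beta}.

Lemma pathsE nu : (nu \in P) = (descend A La (codom nu) == Some b).
Proof. by rewrite inE. Qed.

Definition orth_at nu m : bool := A (nu (lo m)) (nu (hi m)) == 0.

Lemma paths_stransp nu m : nu \in P ->
  (place (stransp m) nu \in P) = orth_at nu m.
Proof.
rewrite !pathsE => /eqP; have [u [v [-> _ ->]]] := codom_swap nu m.
move=> op; have [_ orthP] := descend_orth Asl op.
apply/eqP/eqP => [op'|/[dup] Aab /(descend_swap La Asl) e].
  by apply/orthP; rewrite op'.
by rewrite -op; apply/esym/descend_catl/e.
Qed.

Lemma paths_neq nu m : nu \in P -> nu (lo m) != nu (hi m).
Proof.
rewrite pathsE => /eqP; have [u [v [-> _ _]]] := codom_swap nu m.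
by case/(descend_orth Asl).
Qed.

Lemma paths_noniji nu l m : nu \in P -> m = l.+1 :> nat ->
  nu (lo l) = nu (hi m) -> A (nu (lo l)) (nu (hi l)) <> -1.
Proof.
rewrite pathsE => /eqP op ml e Aab.
have [u [v [es szu _]]] := codom_swap nu l.
have [w [v' [es' szw _]]] := codom_swap nu m.
have lohi : lo m = hi l by apply: val_inj.
have ew : w = rcons u (nu (lo l)).
  move: es'; rewrite es -cat_rcons => /eqP; rewrite eqseq_cat; last first.
    by rewrite size_rcons szu szw ml.
  by case/andP => /eqP->.
move: op; rewrite es' ew cat_rcons lohi -e.
exact: (descend_noniji Asl Aab).
Qed.

(** Coordinates are extended by zero outside P(b), so that operators can be compared at plain
    sequences. *)
Definition hat v nu : k := oapp v 0 (insub nu : option pathType).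

Lemma hat_val v (nu : pathType) : hat v (val nu) = v nu.
Proof. by rewrite /hat valK. Qed.

Lemma hat_out v nu : nu \notin P -> hat v nu = 0.
Proof. by move=> nuP; rewrite /hat insubF // (negPf nuP). Qed.

Lemma hatP u v : (forall nu, nu \in P -> hat u nu = hat v nu) -> u = v.
Proof.
by move=> uv; apply/ffunP => nu; rewrite -!hat_val uv //; case: nu.
Qed.

Lemma hat0 nu : hat 0 nu = 0.
Proof. by rewrite /hat; case: insub => //= p; rewrite ffunE. Qed.

Lemma hatD u v nu : hat (u + v) nu = hat u nu + hat v nu.
Proof.
by rewrite /hat; case: insub => [p|] /=; rewrite ?ffunE ?addr0.
Qed.

Lemma hatZ c v nu : hat (c *: v) nu = c * hat v nu.
Proof.
by rewrite /hat; case: insub => [p|] /=; rewrite ?ffunE ?mulr0.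
Qed.

(** [proj_path] and [cross] are the actions of e(mu) and tau_m. In coordinates tau_m is the pullback
    along the involution s_m, and the extension by zero in [hat] drops the non-paths. *)
Definition proj_path mu v : V := [ffun nu => if val nu == mu then v nu else 0].
Definition cross m v : V := [ffun nu => hat v (place (stransp m) (val nu))].

Lemma hat_proj mu v nu : hat (proj_path mu v) nu = if nu == mu then hat v nu else 0.
Proof.
have [nuP|nuP] := boolP (nu \in P); last by rewrite !hat_out //; case: ifP.
by rewrite -[nu]/(val (Sub nu nuP : pathType)) !hat_val ffunE.
Qed.

Lemma hat_cross m v nu : nu \in P -> hat (cross m v) nu
  = if orth_at nu m then hat v (place (stransp m) nu) else 0.
Proof.
move=> nuP; rewrite -[nu in LHS]/(val (Sub nu nuP : pathType)) hat_val ffunE.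
by case: ifP => // /negbT; rewrite -(paths_stransp _ nuP) => /hat_out->.
Qed.

Lemma proj_pathD mu u v : proj_path mu (u + v) = proj_path mu u + proj_path mu v.
Proof.
by apply: hatP => nu _; rewrite hatD !hat_proj hatD; case: ifP; rewrite ?addr0.
Qed.

Lemma proj_pathZ mu c v : proj_path mu (c *: v) = c *: proj_path mu v.
Proof.
by apply: hatP => nu _; rewrite hatZ !hat_proj hatZ; case: ifP; rewrite ?mulr0.
Qed.

Lemma crossD m u v : cross m (u + v) = cross m u + cross m v.
Proof. by apply/ffunP => nu; rewrite !ffunE hatD. Qed.

Lemma crossZ m c v : cross m (c *: v) = c *: cross m v.
Proof. by apply/ffunP => nu; rewrite !ffunE hatZ. Qed.

Lemma proj_path_out mu v : mu \notin P -> proj_path mu v = 0.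
Proof.
move=> muP; apply: hatP => nu nuP; rewrite hat_proj hat0; case: eqP => // e.
by rewrite -e nuP in muP.
Qed.

Lemma proj_path_id mu v : proj_path mu (proj_path mu v) = proj_path mu v.
Proof. by apply: hatP => nu _; rewrite !hat_proj; case: eqP. Qed.

Lemma proj_path_neq mu mu' v : mu != mu' -> proj_path mu (proj_path mu' v) = 0.
Proof.
move=> ne; apply: hatP => nu _; rewrite !hat_proj hat0.
by case: eqP => // ->; rewrite (negPf ne).
Qed.

Lemma proj_path_sum v : \sum_(nu in Ibeta beta) proj_path nu v = v.
Proof.
apply/ffunP => nu; rewrite sum_ffunE (bigD1 (val nu)) ?P_Ibeta ?(valP nu) //=.
rewrite ffunE eqxx big1 ?addr0 // => mu /andP[_ ne].
by rewrite ffunE eq_sym (negPf ne).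
Qed.

Lemma cross_proj m mu v :
  cross m (proj_path mu v) = proj_path (place (stransp m) mu) (cross m v).
Proof.
apply: hatP => nu nuP; rewrite hat_proj !hat_cross // hat_proj.
have -> : (place (stransp m) nu == mu) = (nu == place (stransp m) mu).
  by apply/eqP/eqP => [<-|->]; rewrite place_stransp_id.
by case: ifP => //; case: ifP.
Qed.

(** Quadratic relation: the right-hand side is Q evaluated at dots that act by zero, which is 1 for
    orthogonal neighbours and 0 otherwise. *)
Lemma cross2_proj m mu v : cross m (cross m (proj_path mu v))
  = if orth_at mu m then proj_path mu v else 0.
Proof.
apply: hatP => nu nuP; rewrite hat_cross //.
case: ifP => [onu|onu]; last first.
  case: ifP => [omu|_]; last by rewrite hat0.
  by rewrite hat_proj; case: eqP => // e; rewrite e omu in onu.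
rewrite hat_cross ?paths_stransp // place_stransp_id hat_proj.
have -> : orth_at (place (stransp m) nu) m.
  by rewrite -paths_stransp ?place_stransp_id // paths_stransp.
case: (altP (nu =P mu)) => [<-|ne]; first by rewrite onu hat_proj eqxx.
by case: ifP; rewrite ?hat_proj ?hat0 // (negPf ne).
Qed.

Lemma cross_comm l m v : (l.+1 < m)%N ->
  cross l (cross m v) = cross m (cross l v).
Proof.
move=> lm; have [flm [fhm [fll fhl]]] : stransp l (lo m) = lo m /\
    stransp l (hi m) = hi m /\ stransp m (lo l) = lo l /\ stransp m (hi l) = hi l.
  by rewrite /stransp; do !split; rewrite tpermD // -val_eqE /=; apply/eqP; lia.
apply: hatP => nu nuP.
have o1 : orth_at (place (stransp l) nu) m = orth_at nu m.
  by rewrite /orth_at !place_stransp flm fhm.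
have o2 : orth_at (place (stransp m) nu) l = orth_at nu l.
  by rewrite /orth_at !place_stransp fll fhl.
have h1 : orth_at nu l -> hat (cross m v) (place (stransp l) nu)
    = if orth_at nu m then hat v (place (stransp m) (place (stransp l) nu)) else 0.
  by move=> ol; rewrite hat_cross ?paths_stransp // o1.
have h2 : orth_at nu m -> hat (cross l v) (place (stransp m) nu)
    = if orth_at nu l then hat v (place (stransp l) (place (stransp m) nu)) else 0.
  by move=> om; rewrite hat_cross ?paths_stransp // o2.
rewrite (hat_cross l _ nuP) (hat_cross m _ nuP).
case: ifP => ol; case: ifP => om; rewrite ?h1 ?h2 ?ol ?om //.
rewrite -!placeM; congr (hat v (place _ nu)).
rewrite (conjgC (stransp m)); congr (_ * _)%g.
by rewrite {2}/stransp tpermJ flm fhm.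
Qed.

(** At a path, both sides vanish unless the three labels are pairwise orthogonal, and then the claim
    is the braid relation of transpositions. *)
Lemma cross_braid l m v : m = l.+1 :> nat ->
  cross m (cross l (cross m v)) = cross l (cross m (cross l v)).
Proof.
move=> ml; have lohi : lo m = hi l by apply: val_inj.
have s1 : stransp m (lo l) = lo l.
  by rewrite /stransp tpermD // -val_eqE /=; apply/eqP; lia.
have s2 : stransp l (hi m) = hi m.
  by rewrite /stransp tpermD // -val_eqE /=; apply/eqP; lia.
have s3 : stransp m (hi l) = hi m by rewrite /stransp -lohi tpermL.
have s4 : stransp m (hi m) = hi l by rewrite /stransp -lohi tpermR.
have s5 : stransp l (hi l) = lo l by rewrite /stransp tpermR.
have s6 : stransp l (lo l) = hi l by rewrite /stransp tpermL.
apply: hatP => nu nuP.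
have E1 : hat (cross m (cross l (cross m v))) nu
  = if [&& orth_at nu m, A (nu (lo l)) (nu (hi m)) == 0 & orth_at nu l]
    then hat v (place (stransp m) (place (stransp l) (place (stransp m) nu))) else 0.
  rewrite hat_cross //; case: ifP => //= om.
  rewrite hat_cross ?paths_stransp // /orth_at !place_stransp s1 s3.
  case: ifP => //= olm; rewrite hat_cross.
    by rewrite /orth_at !place_stransp lohi s5 s2 s1 s4.
  rewrite paths_stransp ?paths_stransp // /orth_at !place_stransp s1 s3.
  exact: olm.
have E2 : hat (cross l (cross m (cross l v))) nu
  = if [&& orth_at nu l, A (nu (lo l)) (nu (hi m)) == 0 & orth_at nu m]
    then hat v (place (stransp l) (place (stransp m) (place (stransp l) nu))) else 0.
  rewrite hat_cross //; case: ifP => //= ol.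
  rewrite hat_cross ?paths_stransp // /orth_at !place_stransp lohi s5 s2.
  case: ifP => //= olm; rewrite hat_cross.
    by rewrite /orth_at !place_stransp s1 s6 s3 s2 ?lohi.
  rewrite paths_stransp ?paths_stransp // /orth_at !place_stransp lohi s5 s2.
  exact: olm.
rewrite E1 E2; case: (orth_at nu l); case: (orth_at nu m); case: (_ == _) => //=.
rewrite -!placeM; congr (hat v (place _ nu)).
have br : (stransp m * stransp l * stransp m = stransp l * stransp m * stransp l)%g.
  apply/permP => x; rewrite !permM.
  have [->|x1] := eqVneq x (lo l); first by rewrite s1 s6 s3 s2.
  have [->|x2] := eqVneq x (hi l); first by rewrite s3 s2 s4 s5 s1 s6.
  have [->|x3] := eqVneq x (hi m); first by rewrite s4 s5 s1 s2 s4.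
  by rewrite /stransp !tpermD ?lohi // eq_sym.
by rewrite -!mulgA in br *; rewrite br.
Qed.

(** The last entry is the first operator applied to [La]. Hence the cyclotomic generator at a path
    contains a dot to the first power. *)
Lemma paths_last nu (l : 'I_N) : nu \in P -> l.+1 = N -> La 0 (nu l) = 1.
Proof.
rewrite pathsE => /eqP op lN.
have es : codom nu = rcons (take l (codom nu)) (nu l).
  rewrite -{1}(cat_take_drop l (codom nu)) (drop_nth (nu l)) ?size_codom_ord //.
  by rewrite nth_codom_ord lN drop_oversize ?size_codom_ord // cats1.
rewrite es -cats1 in op; have [nu'] := descend_cat op.
by case/descend_cons => mu' [<-] [].
Qed.

(* The free algebra is kept abstract here: unification would otherwise unfold
   its multiplication. *)
Section RelationsActByZero.
Variables (F : algType k) (act : F -> V -> V).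
Variables (e : I_N -> F) (x : 'I_N -> F) (tau : 'I_N.-1 -> F).
Hypotheses (act1 : forall v, act 1 v = v)
  (actM : forall a a' v, act (a * a') v = act a (act a' v))
  (actD : forall a a' v, act (a + a') v = act a v + act a' v)
  (actB : forall a a' v, act (a - a') v = act a v - act a' v)
  (actZ : forall c a v, act (c *: a) v = c *: act a v)
  (act0 : forall v, act 0 v = 0) (actN : forall a v, act (- a) v = - act a v).
Hypotheses (act_e : forall nu v, nu \in Ibeta beta -> act (e nu) v = proj_path nu v)
  (act_x : forall (l : 'I_N) v, act (x l) v = 0)
  (act_tau : forall m v, act (tau m) v = cross m v).

Let act_sum (I : finType) (S : {pred I}) (f : I -> F) v :
  act (\sum_(i in S) f i) v = \sum_(i in S) act (f i) v.
Proof. exact: (big_morph (act^~ v) (fun a a' => actD a a' v) (act0 v)). Qed.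

Let cross0 m : cross m 0 = 0.
Proof. by apply: (addrI (cross m 0)); rewrite -crossD !addr0. Qed.

Let proj0 mu : proj_path mu 0 = 0.
Proof. by apply: (addrI (proj_path mu 0)); rewrite -proj_pathD !addr0. Qed.

Let Adiag j : A j j = 2. Proof. by case: Asl. Qed.
Let Aoff (j l : 'I_n) : j != l -> A j l = 0 \/ A j l = -1.
Proof. by case: Asl => _ _; exact. Qed.

Lemma act_eval2 i j (l l' : 'I_N) v :
  act (eval2 (Q i j) (x l) (x l')) v = if A i j == 0 then v else 0.
Proof.
have [->|/Aoff[Aij|Aij]] := eqVneq i j.
- by rewrite eval2_eq act0 Adiag.
- by rewrite (eval2_orth Qp) // Aij act1.
- by rewrite (eval2_adj _ Asl d_sym) // Aij actD !actZ !act_x !scaler0 addr0.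
Qed.

Lemma act_rel_ee nu nu' v : nu \in Ibeta beta -> nu' \in Ibeta beta ->
  act (e nu * e nu' - if nu == nu' then e nu else 0) v = 0.
Proof.
move=> nuI nu'I; rewrite actB actM !act_e //.
have [<-|ne] := eqVneq nu nu'; first by rewrite act_e // proj_path_id subrr.
by rewrite act0 proj_path_neq // subr0.
Qed.

Lemma act_rel_e1 v : act (\sum_(nu in Ibeta beta) e nu - 1) v = 0.
Proof.
rewrite actB act_sum act1; apply/eqP; rewrite subr_eq0; apply/eqP.
by rewrite -[RHS]proj_path_sum; apply: eq_bigr => nu /act_e->.
Qed.

Lemma act_rel_xx (l m : 'I_N) v : act (x l * x m - x m * x l) v = 0.
Proof. by rewrite actB !actM !act_x subrr. Qed.

Lemma act_rel_xe (l : 'I_N) nu v : nu \in Ibeta beta ->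
  act (x l * e nu - e nu * x l) v = 0.
Proof. by move=> nuI; rewrite actB !actM !act_x act_e // proj0 subrr. Qed.

Lemma act_rel_te m nu v : nu \in Ibeta beta ->
  act (tau m * e nu - e (place (stransp m) nu) * tau m) v = 0.
Proof.
move=> nuI; rewrite actB !actM !act_tau !act_e ?Ibeta_stransp //.
by rewrite cross_proj subrr.
Qed.

Lemma act_rel_tt l m v : ((l.+1 < m) || (m.+1 < l))%N ->
  act (tau l * tau m - tau m * tau l) v = 0.
Proof.
move=> lm; rewrite actB !actM !act_tau; apply/eqP; rewrite subr_eq0; apply/eqP.
by case/orP: lm => lm; rewrite (cross_comm _ lm).
Qed.

Lemma act_rel_t2 l nu v : nu \in Ibeta beta ->
  act (tau l ^+ 2 * e nu
       - eval2 (Q (nu (lo l)) (nu (hi l))) (x (lo l)) (x (hi l)) * e nu) v = 0.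
Proof.
move=> nuI; rewrite actB expr2 !actM !act_tau act_eval2 !act_e //.
by rewrite cross2_proj subrr.
Qed.

Lemma act_rel_tx l (m : 'I_N) nu v : nu \in Ibeta beta ->
  act ((tau l * x m - x (stransp l m) * tau l) * e nu
       - if (m == lo l) && (nu (lo l) == nu (hi l)) then - e nu
         else if (m == hi l) && (nu (lo l) == nu (hi l)) then e nu
         else 0) v = 0.
Proof.
move=> nuI; rewrite actB actM actB !actM !act_x act_tau cross0 subrr sub0r.
have [nuP|nuP] := boolP (nu \in P).
  by rewrite (negPf (paths_neq l nuP)) !andbF act0 oppr0.
by case: ifP => _; [|case: ifP => _]; rewrite ?actN ?act0 ?act_e ?proj_path_out ?oppr0.
Qed.

Lemma act_rel_braid l m nu v : m = l.+1 :> nat -> nu \in Ibeta beta ->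
  act ((tau m * tau l * tau m - tau l * tau m * tau l) * e nu
       - if nu (lo l) == nu (hi m)
         then divdiff (Q (nu (lo l)) (nu (hi l)))
                (x (lo l)) (x (hi l)) (x (hi m)) * e nu
         else 0) v = 0.
Proof.
move=> ml nuI; rewrite actB actM actB !actM !act_tau (cross_braid _ ml) subrr sub0r.
case: eqP => [lm|_]; last by rewrite act0 oppr0.
have [nuP|nuP] := boolP (nu \in P); last first.
  rewrite actM act_e // proj_path_out //; apply/eqP; rewrite oppr_eq0; apply/eqP.
  have [->|/Aoff[Aij|Aij]] := eqVneq (nu (lo l)) (nu (hi l)).
  - by rewrite divdiff_eq act0.
  - by rewrite (divdiff_orth Qp) // act0.
  - by rewrite (divdiff_adj _ Asl d_sym) // actZ act1 scaler0.
(* A path contains no consecutive j l j with a_jl = -1, so the labels are orthogonal and the divided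
   difference is zero. *)
have /Aoff[Aij|/(paths_noniji nuP ml lm)//] := paths_neq l nuP.
by rewrite (divdiff_orth Qp) // mul0r act0 oppr0.
Qed.

Lemma act_rel_cyc (l : 'I_N) nu v : l.+1 = N -> nu \in Ibeta beta ->
  act (x l ^+ `|La 0 (nu l)| * e nu) v = 0.
Proof.
move=> lN nuI; rewrite actM act_e //.
have [nuP|nuP] := boolP (nu \in P).
  by rewrite (paths_last nuP lN) expr1 act_x.
rewrite proj_path_out //; elim: `|_|%N => [|r IH]; first by rewrite expr0 act1.
by rewrite exprS actM act_x.
Qed.

End RelationsActByZero.

Local Notation R := (cyclotomicQH A d t beta La).
Local Notation cycl := (cycl A d t (beta := beta) La).

Definition gen_act (g : qhgen beta) (v : V) : V :=
  match g with
  | inl (inl mu) => proj_path (val mu) v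
  | inl (inr _) => 0
  | inr m => cross m v
  end.

(** The generators act first through the free algebra; the quiver Hecke relations and the cyclotomic
    relations are then divided out in turn. *)
Lemma path_action : exists act : R -> V -> V,
  [/\ is_module act,
      forall nu v, nu \in Ibeta beta -> act (cycl (gen_e k nu)) v = proj_path nu v,
      forall (l : 'I_N) v, act (cycl (gen_x k l)) v = 0
    & forall m v, act (cycl (gen_tau k m)) v = cross m v].
Proof.
have gD g u v : gen_act g (u + v) = gen_act g u + gen_act g v.
  case: g => [[mu|l]|m] /=; [exact: proj_pathD | by rewrite addr0 | exact: crossD].
have gZ g c v : gen_act g (c *: v) = c *: gen_act g v.
  case: g => [[mu|l]|m] /=; [exact: proj_pathZ | by rewrite scaler0 | exact: crossZ].
have [act [act_mod actg]] := freeAlg_action gD gZ.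
have ae nu v : nu \in Ibeta beta -> act (gen_e k nu) v = proj_path nu v.
  by move=> nuI; rewrite /gen_e insubT actg.
have ax (l : 'I_N) v : act (gen_x k l) v = 0 by rewrite /gen_x actg.
have at_ m v : act (gen_tau k m) v = cross m v by rewrite /gen_tau actg.
have a1 := mact1 act_mod; have aM := mactM act_mod; have aD := mactDl act_mod.
have aB := mactBl act_mod; have a0 := mact0l act_mod; have aN := mactNl act_mod.
have aZ c a v : act (c *: a) v = c *: act a v.
  by rewrite -mulr_algl aM -(mact_algin act_mod).
have rel0 a v : qhrel A d t a -> act a v = 0.
  case.
  - move=> nu nu' nuI nu'I; exact: act_rel_ee.
  - exact: act_rel_e1.
  - move=> l m; exact: act_rel_xx.
  - move=> l nu; exact: act_rel_xe.
  - move=> m nu; exact: act_rel_te.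
  - move=> l m; exact: act_rel_tt.
  - move=> l nu; exact: act_rel_t2.
  - move=> l m nu; exact: act_rel_tx.
  - move=> l m nu; exact: act_rel_braid.
have [qact [qact_mod qactE]] := quotAlg_action act_mod (fun a v => @rel0 a v).
have cyc0 (g : quiverHecke A d t beta) v : cycrel La g -> qact g v = 0.
  case=> l nu lN nuI; rewrite pairing_scoroot.
  have -> : qh_x A d t l ^+ `|La 0 (nu l)| * qh_e A d t nu
      = qproj (qhrel A d t (beta := beta)) (gen_x k l ^+ `|La 0 (nu l)| * gen_e k nu).
    by rewrite /qh_x /qh_e -rmorphXn -rmorphM.
  rewrite qactE; exact: act_rel_cyc.
have [ract [ract_mod ractE]] := quotAlg_action qact_mod (fun g v => @cyc0 g v).
by exists ract; split=> // *; rewrite /cycl /cycproj ractE qactE ?ae.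
Qed.

End PathModule.

(** * The basis *)

Lemma exch_orth_path n (A : 'M[int]_n) s u : exch A s u -> exists w, orth_path A s w u.
Proof.
elim=> [|w a c v _ [r sr] Aac]; first by exists [::]; exact: orth_path0.
by exists (size w :: r); exact: orth_pathS.
Qed.

(** * Spanning, independence, grading and simplicity *)

Section PathAlgebra.
Variables (k : fieldType) (n : nat) (A : 'M[int]_n) (d : 'I_n -> nat).
Variables (t : 'I_n -> 'I_n -> nat -> nat -> k) (La b : weight n).
Variable beta : posroot n.
Hypothesis (Asl : simply_laced A).
Hypothesis (d_sym : symmetrizer A d).
Hypothesis (Qp : Qparam A d t).
Hypotheses (La_dom : dominant La) (La_min : minuscule A La).

Local Notation N := (ht beta).
Local Notation I_N := (Iseq n N).
Local Notation P := (paths A La b N).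
Local Notation pathType := (pathType A La b beta).
Local Notation V := (Smod k A La b beta).
Local Notation R := (cyc_ring A d t beta La).
Local Notation cycl := (cycl A d t (beta := beta) La).
Local Notation E := (Eseq A d t beta La).
Local Notation X := (Xnat A d t beta La).
Local Notation T := (Tnat A d t beta La).
Local Notation pvec := (pvec k A La b).
Local Notation tauw := (tword T).
Implicit Types (nu mu : I_N) (v : V) (m : 'I_N.-1).

Hypothesis P_Ibeta : {subset P <= Ibeta beta}.
(** A sequence of content [beta] can descend only to the weight [La] minus [beta], which is [b] in
    the application. *)
Hypothesis P_complete : forall nu, nu \in Ibeta beta -> nu \notin P ->
  descend A La (codom nu) = None.
Hypothesis P_inhabited : exists nu, nu \in P.

Let mh := cycl_minuscule beta Asl d_sym Qp La_dom.

Lemma Eseq_path nu : nu \in P -> E (codom nu) = cycl (gen_e k nu).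
Proof. by rewrite Eseq_codom. Qed.

Lemma Eseq_notpath nu : nu \notin P -> E (codom nu) = 0.
Proof.
move=> nuP; have [nuI|nuI] := boolP (nu \in Ibeta beta).
  by have [+ _] := vanishing Asl La_dom La_min mh (codom nu) [::]; apply; exact: P_complete.
by rewrite Eseq_codom gen_e_notin // cycl0.
Qed.

Lemma Xnat_Eseq q nu : (q < N)%N -> X q * E (codom nu) = 0.
Proof.
move=> qN; have [_] := vanishing Asl La_dom La_min mh (codom nu) [::].
by apply; rewrite /= size_codom_ord.
Qed.

Lemma paths_connected nu mu : nu \in P -> mu \in P ->
  exch A (codom mu) (codom nu).
Proof.
rewrite !pathsE => /eqP nuP /eqP muP.
by apply: (descend_connected Asl La_dom La_min _ muP nuP); rewrite !size_codom_ord.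
Qed.

Lemma exchange_permP nu mu : nu \in P -> mu \in P ->
  exchanges A mu nu (exchange_perm A nu mu).
Proof.
move=> nuP muP; have [nu' [w [enu ex]]] := exch_exchanges (paths_connected nuP muP).
rewrite -(codom_inj enu) /exchange_perm; case: pickP => [w' /boolp.asboolP //|/(_ w)].
by move/boolp.asboolP => [].
Qed.

Lemma orth_path_codom nu s u : orth_path A (codom nu) s u ->
  exists mu, codom mu = u.
Proof.
elim=> [|w u' a c v _ [mu emu] _]; first by exists nu.
by have [m [_ _ _ e]] := codom_split emu; exists (place (stransp m) mu).
Qed.

Lemma orth_path_paths nu s mu :
  nu \in P -> orth_path A (codom nu) s (codom mu) -> mu \in P.
Proof.
rewrite !pathsE => /eqP <- sp; apply/eqP.
elim: sp => // w u a c v _ <- Aac; apply/esym/descend_catl.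
exact: (descend_swap La Asl).
Qed.

Section Words.
Variable rex : 'S_N -> seq 'I_N.-1.
Hypothesis rex_reduced : forall w, reduced_expression w (rex w).

Local Notation cvec := (cvec A d t La b rex).

(** The reduced word of the exchange permutation consists of orthogonal exchanges, and the left
    idempotent is absorbed on moving it to the right. *)
Lemma cvecE (nu mu : pathType) : exists s,
  orth_path A (codom (val mu)) s (codom (val nu)) /\
  cvec nu mu = tauw s * E (codom (val mu)).
Proof.
have ex := exchange_permP (valP nu) (valP mu).
set w := exchange_perm _ _ _ in ex.
have [nuE wlt] := exchanges_orth ex.
exists [seq val m | m <- rex w]; have := reduced_orth_path (rex_reduced w) wlt.
rewrite -nuE => sp; split; first exact: sp.
suff -> : cvec nu mu
    = E (codom (val nu)) * tauw [seq val m | m <- rex w] * E (codom (val mu)).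
  by rewrite -(orth_path_TE mh sp) -mulrA (mh_EE mh).
have tauE : cycproj La (qh_tauw A d t rex w) = tauw [seq val m | m <- rex w].
  rewrite /qh_tauw cycproj_prod /tword big_map.
  by apply: eq_bigr => m _; rewrite Tnat_val.
rewrite !Eseq_codom -tauE.
exact: etrans (cycprojM _ _ _) (congr1 ( *%R^~ _) (cycprojM _ _ _)).
Qed.

Lemma cvec_unique (nu mu : pathType) s :
  orth_path A (codom (val mu)) s (codom (val nu)) ->
  tauw s * E (codom (val mu)) = cvec nu mu.
Proof.
by move=> sp; have [s' [sp' ->]] := cvecE nu mu; exact: (orth_path_unique Asl mh sp sp').
Qed.

Definition in_span (r : R) : Prop :=
  exists f : pathType * pathType -> k, r = \sum_p f p *: cvec p.1 p.2.

Lemma in_span0 : in_span 0.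
Proof. by exists (fun=> 0); rewrite big1 // => p _; rewrite scale0r. Qed.

Lemma in_spanD r r' : in_span r -> in_span r' -> in_span (r + r').
Proof.
move=> [f ->] [g ->]; exists (fun p => f p + g p); rewrite -big_split /=.
by apply: eq_bigr => p _; rewrite scalerDl.
Qed.

Lemma in_spanZ c r : in_span r -> in_span (c *: r).
Proof.
move=> [f ->]; exists (fun p => c * f p); rewrite scaler_sumr.
by apply: eq_bigr => p _; rewrite scalerA.
Qed.

Lemma in_span_cvec (nu mu : pathType) : in_span (cvec nu mu).
Proof.
exists (fun p => (p == (nu, mu))%:R); rewrite (bigD1 (nu, mu)) //= eqxx scale1r.
by rewrite big1 ?addr0 // => p /negPf->; rewrite scale0r.
Qed.

(** An idempotent keeps or kills, and a dot kills. A crossing leads either to another path, where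
    [cvec_unique] identifies the result, or to a sequence whose idempotent is zero. *)
Lemma in_span_gen_cvec (g : qhgen beta) (nu mu : pathType) :
  in_span (cycl (fgen k g) * cvec nu mu).
Proof.
have [s [sp cE]] := cvecE nu mu.
have cE' := etrans cE (orth_path_TE mh sp).
case: g => [[ka|l]|m].
- have -> : cycl (fgen k (inl (inl ka) : qhgen beta)) = E (codom (val ka)).
    by rewrite Eseq_codom /gen_e valK.
  rewrite cE' mulrA; have [e|ne] := eqVneq (val ka) (val nu).
    by rewrite e (mh_EE mh) -cE'; exact: in_span_cvec.
  have nuI := P_Ibeta (valP nu); have kaI := valP ka.
  have H := cycl_rel La (qhrel_ee A d t kaI nuI).
  rewrite (negPf ne) subr0 in H.
  rewrite !Eseq_codom -(cyclM A d t La (gen_e k (val ka)) (gen_e k (val nu))) H mul0r.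
  exact: in_span0.
- rewrite -[cycl _]/(cycl (gen_x k l)) -(Xnat_val A d t La l) cE' mulrA.
  rewrite (Xnat_Eseq (val nu) (ltn_ord l)) mul0r; exact: in_span0.
rewrite -[cycl _]/(cycl (gen_tau k m)) -(Tnat_val A d t La m).
have [u [v [e szu e']]] := codom_swap (val nu) m.
have [smP|smP] := boolP (place (stransp m) (val nu) \in P).
  have sp' : orth_path A (codom (val mu)) (val m :: s)
      (codom (val (Sub (place (stransp m) (val nu)) smP : pathType))).
    rewrite e' -[val m]szu; apply: orth_pathS; first by rewrite -e.
    by apply/eqP; rewrite -[_ == _]/(orth_at A _ _) -(paths_stransp Asl m (valP nu)).
  rewrite cE mulrA -(tword_cons T) (cvec_unique sp'); exact: in_span_cvec.
rewrite cE' mulrA e -[nat_of_ord m]szu (mh_TE mh) -e' (Eseq_notpath smP) !mul0r.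
exact: in_span0.
Qed.

Lemma in_span_gen (g : qhgen beta) r : in_span r -> in_span (cycl (fgen k g) * r).
Proof.
move=> [f ->]; rewrite mulr_sumr; elim/big_ind: _ => [||p _].
- exact: in_span0.
- exact: in_spanD.
rewrite cyc_scalerAr; apply: in_spanZ; exact: in_span_gen_cvec.
Qed.

Lemma in_span1 : in_span 1.
Proof.
have H := cycl_rel La (qhrel_e1 A d t beta); rewrite cyclB cycl1 in H.
move/eqP: H; rewrite subr_eq0 => /eqP <-; rewrite cycl_sum.
elim/big_ind: _ => [||nu _]; [exact: in_span0 | exact: in_spanD |].
rewrite -Eseq_codom; have [nuP|nuP] := boolP (nu \in P); last first.
  rewrite (Eseq_notpath nuP); exact: in_span0.
(* The empty word identifies e(nu) with c_{nu,nu}. *)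
have := @cvec_unique (Sub nu nuP) (Sub nu nuP) [::] (orth_path0 _ _).
rewrite /tword big_nil mul1r => ->; exact: in_span_cvec.
Qed.

(** The span contains 1 and is stable under left multiplication by the generators. *)
Lemma in_span_all r : in_span r.
Proof.
have [a ->] := cycl_surj r.
suff H r' : in_span r' -> in_span (cycl a * r').
  rewrite -[cycl a]mulr1; apply: H; exact: in_span1.
elim/freeAlg_ind: a r' => {r}[||a a' IH IH'|c a IH|g a IH] r' r'S.
- rewrite cycl0 mul0r; exact: in_span0.
- rewrite cycl1 mul1r; exact: r'S.
- rewrite cyclD mulrDl; apply: in_spanD; [exact: IH | exact: IH'].
- rewrite cyclZ cyc_scalerAl; apply: in_spanZ; exact: IH.
- rewrite cyclM -mulrA; apply: in_span_gen; exact: IH.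
Qed.

End Words.

Section Action.
Variable act : R -> V -> V.
Hypothesis act_mod : is_module act.
Hypotheses (act_e : forall nu v, nu \in Ibeta beta ->
    act (cycl (gen_e k nu)) v = proj_path nu v)
  (act_x : forall (l : 'I_N) v, act (cycl (gen_x k l)) v = 0)
  (act_tau : forall m v, act (cycl (gen_tau k m)) v = cross m v).

Lemma hat_pvec nu mu : nu \in P -> hat (pvec mu) nu = (nu == mu)%:R.
Proof.
by move=> nuP; rewrite -[nu in LHS]/(val (Sub nu nuP : pathType)) hat_val ffunE.
Qed.

Lemma proj_pvec mu nu : proj_path mu (pvec nu) = if nu == mu then pvec nu else 0.
Proof.
apply: hatP => ka kaP; rewrite hat_proj; case: (altP (nu =P mu)) => [->|ne].
  by case: eqP => // ne; rewrite hat_pvec //; case: eqP.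
by rewrite hat0; case: eqP => // e; rewrite hat_pvec // e eq_sym (negPf ne).
Qed.

Lemma cross_pvec m nu : nu \in P -> cross m (pvec nu)
  = if place (stransp m) nu \in P then pvec (place (stransp m) nu) else 0.
Proof.
move=> nuP; apply: hatP => ka kaP; rewrite (hat_cross Asl) //.
have keq : (place (stransp m) ka == nu) = (ka == place (stransp m) nu).
  by apply/eqP/eqP => [<-|->]; rewrite place_stransp_id.
case: ifP => ok.
  have skaP : place (stransp m) ka \in P by rewrite (paths_stransp Asl).
  rewrite hat_pvec // keq; case: ifP => snP; first by rewrite hat_pvec.
  by rewrite hat0; case: eqP => // e; rewrite -e kaP in snP.
case: ifP => snP; last by rewrite hat0.
rewrite hat_pvec //; case: eqP => // e.
by rewrite -(paths_stransp Asl m kaP) e place_stransp_id nuP in ok.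
Qed.

Lemma Smod_pvec v : v = \sum_(nu : pathType) v nu *: pvec (val nu).
Proof.
apply/ffunP => ka; rewrite sum_ffunE (bigD1 ka) //= !ffunE eqxx.
rewrite big1 ?addr0 => [|nu ne]; first by rewrite [RHS]mulr1.
by rewrite !ffunE (inj_eq val_inj) eq_sym (negPf ne) [LHS]mulr0.
Qed.

Lemma act_Eseq nu ka : nu \in P -> ka \in P ->
  act (E (codom nu)) (pvec ka) = if ka == nu then pvec nu else 0.
Proof.
move=> nuP kaP; rewrite Eseq_path // act_e ?P_Ibeta // proj_pvec.
by case: eqP => // ->.
Qed.

Lemma act_tword s nu mu : nu \in P -> orth_path A (codom nu) s (codom mu) ->
  act (tauw s) (pvec nu) = pvec mu.
Proof.
move=> nuP; move eu: (codom mu) => u sp; elim: sp mu eu => [|{}s w a c v sp IH Aac] mu eu.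
  by rewrite /tword big_nil (mact1 act_mod) -(codom_inj eu).
have [ka eka] := orth_path_codom sp.
rewrite -eka in sp; have kaP := orth_path_paths nuP sp.
rewrite (tword_cons T) (mactM act_mod) (IH ka eka).
have [m [mw nua nuc e']] := codom_split eka.
have -> : mu = place (stransp m) ka by apply: codom_inj; rewrite e' eu.
rewrite -mw Tnat_val act_tau cross_pvec // (paths_stransp Asl) //.
by rewrite /orth_at nua nuc Aac eqxx.
Qed.

Lemma cvec_act rex (nu mu ka : pathType) :
  (forall w, reduced_expression w (rex w)) ->
  act (cvec A d t La b rex nu mu) (pvec (val ka))
  = if ka == mu then pvec (val nu) else 0.
Proof.
move=> rexP; have [s [sp ->]] := cvecE rexP nu mu.
rewrite (mactM act_mod) act_Eseq ?(valP mu) ?(valP ka) // (inj_eq val_inj).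
case: ifP => _; last by rewrite (mact0r act_mod).
exact: act_tword (valP mu) sp.
Qed.

Lemma cvec_basis rex : (forall w, reduced_expression w (rex w)) ->
  is_basis (fun p : pathType * pathType => cvec A d t La b rex p.1 p.2).
Proof.
move=> rexP; split=> [r|f f0 [nu mu]]; first exact: in_span_all.
(* By the matrix unit action, the coordinate at [nu] of the image of p(mu) isolates the coefficient
   of c_{nu,mu}. *)
have /ffunP/(_ nu) : act (\sum_p f p *: cvec A d t La b rex p.1 p.2)
    (pvec (val mu)) = 0 by rewrite f0 (mact0l act_mod).
rewrite (mact_sum act_mod) sum_ffunE (bigD1 (nu, mu)) //= big1 => [|[nu' mu'] ne].
  rewrite addr0 cyc_scaleE (mactM act_mod).
  by rewrite (mact_algin act_mod) cvec_act // eqxx !ffunE eqxx [LHS]mulr1.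
rewrite cyc_scaleE (mactM act_mod).
rewrite (mact_algin act_mod) cvec_act //=.
have [e|_] := eqVneq mu mu'; last by rewrite scaler0 ffunE.
have nn : nu != nu' by apply: contra ne => /eqP->; rewrite e.
by rewrite !ffunE (inj_eq val_inj) (negPf nn) [LHS]mulr0.
Qed.

Lemma act_Saction : Saction act.
Proof.
split=> [mu nu muI nuP|l mu nu muI nuP|m mu nu muI nuP].
- rewrite -[cycproj _ _]/(cycl (gen_e k mu)) act_e //; exact: proj_pvec.
- have -> : cycproj La (qh_x A d t l * qh_e A d t mu)
      = cycl (gen_x k l) * cycl (gen_e k mu) by exact: cycprojM.
  by rewrite (mactM act_mod) act_x.
have -> : cycproj La (qh_tau A d t m * qh_e A d t mu)
    = cycl (gen_tau k m) * cycl (gen_e k mu) by exact: cycprojM.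
rewrite (mactM act_mod) act_e // act_tau proj_pvec.
case: eqP => _ /=; first exact: cross_pvec.
by apply: hatP => ka kaP; rewrite (hat_cross Asl) // !hat0; case: ifP.
Qed.

(** This makes degree 0 a consistent placement of S(b): dots act by zero, and tau_m e(nu) acts by a
    nonzero operator only at orthogonal neighbours, where its degree is 0. *)
Lemma act_qhdeg r a : qhdeg r a ->
  r = 0 \/ forall v, act (cycproj La a) v = 0.
Proof.
elim=> {r a}.
- by move=> nu _; left.
- move=> l nu _; right=> v.
  have -> : cycproj La (qh_x A d t l * qh_e A d t nu)
      = cycl (gen_x k l) * cycl (gen_e k nu) by exact: cycprojM.
  by rewrite (mactM act_mod) act_x.
- move=> m nu nuI.
  have tauE v : act (cycproj La (qh_tau A d t m * qh_e A d t nu)) v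
      = proj_path (place (stransp m) nu) (cross m v).
    have -> : cycproj La (qh_tau A d t m * qh_e A d t nu)
        = cycl (gen_tau k m) * cycl (gen_e k nu) by exact: cycprojM.
    by rewrite (mactM act_mod) act_e // act_tau (cross_proj Asl).
  have [nuP|nuP] := boolP (nu \in P); last first.
    right=> v; rewrite tauE -(cross_proj Asl) proj_path_out //.
    by apply: hatP => ka kaP; rewrite (hat_cross Asl) // !hat0; case: ifP.
  have [/eqP Anu|onu] := boolP (orth_at A nu m).
    by left; rewrite /Defs.form Anu mulr0 oppr0.
  by right=> v; rewrite tauE proj_path_out // (paths_stransp Asl).
- move=> r s a a' _ IHa _ IHa'.
  have aM v : act (cycproj La (a * a')) v = act (cycproj La a) (act (cycproj La a') v).
    exact: etrans (congr1 (act^~ v) (cycprojM _ _ _)) (mactM act_mod _ _ _).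
  case: IHa => [->|a0]; last by right=> v; rewrite aM a0.
  by case: IHa' => [->|a0]; [left | right=> v; rewrite aM a0 (mact0r act_mod)].
- by move=> r; right=> v; rewrite /cycproj raddf0 (mact0l act_mod).
- move=> r a a' _ [->|a0] _ IHa'; first by left.
  case: IHa' => [->|a0']; first by left.
  by right=> v; rewrite /cycproj raddfD (mactDl act_mod) a0 a0' addr0.
- move=> r c a _ [->|a0]; first by left.
  right=> v; rewrite -[c *: a]/(algin c * a).
  have -> : cycproj La (algin c * a) = cycproj La (algin c) * cycproj La a.
    exact: cycprojM.
  by rewrite (mactM act_mod) a0 (mact0r act_mod).
Qed.

Lemma act_graded : is_graded act (cycdeg A d t La) (placed_in 0).
Proof.
split=> [r|v|s f us f0 sf r rs|r s a v [a' aD ->] vs].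
- split=> [|u v [->|->] [r0|->]|c u [->|->]]; rewrite /placed_in ?addr0 ?scaler0;
    by [left | right].
- exists [:: 0], (fun r => if r == 0 then v else 0); split=> [r|].
    by rewrite /placed_in; case: eqP; [left | right].
  by rewrite big_seq1 eqxx.
- have [fr|] := boolp.pselect (r = 0); last by case: (f0 r).
  move: sf; rewrite (bigD1_seq r) //= big1 ?addr0 // => j jr.
  by case: (f0 j) => // j0; rewrite j0 fr eqxx in jr.
- case: vs => [->|->]; last by right; rewrite (mact0r act_mod).
  by case: (act_qhdeg aD) => [->|a0]; [left; rewrite addr0 | right].
Qed.

(** In a nonzero submodule, e(nu) at a nonzero coordinate isolates p(nu), and words of exchanges
    carry it to every other p(mu). *)
Lemma act_simple : is_simple act.
Proof.
split.
  have [nu nuP] := P_inhabited; exists (pvec nu).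
  apply/eqP => /(congr1 (fun v => hat v nu)); rewrite hat_pvec // hat0 eqxx.
  by move/eqP; rewrite oner_eq0.
move=> U [U0 UD Uact]; have [[v [Uv v0]]|noU] :=
  boolp.pselect (exists v, U v /\ v <> 0); last first.
  by left=> v Uv; have [//|/eqP v0] := eqVneq v 0; case: noU; exists v.
right=> w.
have UZ c u : U u -> U (c *: u) by rewrite -(mact_algin act_mod); exact: Uact.
have [nu vnu] : exists nu : pathType, v nu != 0.
  apply: boolp.contrapT => nov; apply: v0; apply/ffunP => nu; rewrite ffunE.
  by apply/eqP/negPn/negP => vnu; apply: nov; exists nu.
have Unu : U (pvec (val nu)).
  have := Uact (cycl (gen_e k (val nu))) v Uv.
  rewrite act_e ?P_Ibeta ?(valP nu) // => /(UZ (v nu)^-1).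
  congr U; apply/ffunP => ka; rewrite !ffunE (inj_eq val_inj).
  by case: eqP => [->|_]; [exact: mulVf | exact: mulr0].
have Uall (mu : pathType) : U (pvec (val mu)).
  have [s sp] := exch_orth_path (paths_connected (valP mu) (valP nu)).
  by rewrite -(act_tword (valP nu) sp); exact: Uact.
rewrite [w]Smod_pvec; elim/big_ind: _ => // mu _; exact/UZ/Uall.
Qed.

End Action.

End PathAlgebra.

(** * Content of paths and assembly of the theorem *)

Lemma ht_sum_delta n (s : seq 'I_n) :
  ht (\sum_(j <- s) delta_mx 0 j : posroot n) = size s.
Proof.
rewrite /ht; under eq_bigr => i _ do rewrite summxE.
rewrite exchange_big -sum1_size; apply: eq_bigr => j _.
rewrite (bigD1 j) //= big1 => [|i ij]; rewrite mxE !eqxx //=.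
by rewrite (negPf ij).
Qed.

Lemma sum_codom (V : nmodType) (I J : finType) (f : I -> J) (g : J -> V) :
  \sum_(j <- codom f) g j = \sum_i g (f i).
Proof. by rewrite big_map big_enum. Qed.

Lemma descend_content (X : dynkin) (La b : weight (rank X))
    (beta : posroot (rank X)) (s : seq 'I_(rank X)) :
  dynkin_wf X -> La - b = weight_of (cartan X) beta ->
  descend (cartan X) La s = Some b -> \sum_(j <- s) delta_mx 0 j = beta.
Proof.
move=> wf betaE op; apply: (weight_of_inj wf).
by rewrite -weight_of_count -betaE (descend_weight op) opprB addrC subrK.
Qed.

Theorem theorem2p9 (k : fieldType) (X : dynkin)
    (d : 'I_(rank X) -> nat)
    (t : 'I_(rank X) -> 'I_(rank X) -> nat -> nat -> k)
    (i : 'I_(rank X)) (b : weight (rank X)) (beta : posroot (rank X))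
    (rex : 'S_(ht beta) -> seq 'I_(ht beta).-1) :
  dynkin_wf X ->
  symmetrizer (cartan X) d ->
  Qparam (cartan X) d t ->
  dominant (fweight i) -> minuscule (cartan X) (fweight i) ->
  weyl_orbit (cartan X) (fweight i) b ->
  fweight i - b = weight_of (cartan X) beta ->
  (forall w, reduced_expression w (rex w)) ->
  (exists act : cyclotomicQH (cartan X) d t beta (fweight i) ->
                Smod k (cartan X) (fweight i) b beta ->
                Smod k (cartan X) (fweight i) b beta,
     [/\ is_module act, Saction act, is_simple act,
         is_graded act (cycdeg (cartan X) d t (fweight i)) (placed_in 0)
       & is_homogeneous (placed_in (V := Smod k (cartan X) (fweight i) b beta)
                                   0)])
  /\
  is_basis (fun p : pathType (cartan X) (fweight i) b beta
                    * pathType (cartan X) (fweight i) b beta =>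
              cvec (cartan X) d t (fweight i) b rex p.1 p.2).
Proof.
move=> wf d_sym Qp La_dom La_min b_orbit betaE rexP.
have Asl := cartan_simply_laced X.
have P_Ibeta : {subset paths (cartan X) (fweight i) b (ht beta) <= Ibeta beta}.
  move=> nu; rewrite pathsE inE => /eqP op.
  by apply/eqP; rewrite -[RHS](descend_content wf betaE op) sum_codom.
have P_complete (nu : Iseq (rank X) (ht beta)) : nu \in Ibeta beta ->
    nu \notin paths (cartan X) (fweight i) b (ht beta) ->
    descend (cartan X) (fweight i) (codom nu) = None.
  (* The weight reached depends only on the content [beta], so it is [b] as soon as the descent
     succeeds. *)
  rewrite pathsE inE => /eqP nuI; case E: (descend _ _ _) => [mu|] //.
  case/eqP; congr Some; rewrite (descend_weight E) weight_of_count sum_codom nuI.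
  by rewrite -betaE opprB addrC subrK.
have P_inhabited : exists nu, nu \in paths (cartan X) (fweight i) b (ht beta).
  have [s op] := descend_orbit Asl La_dom La_min b_orbit.
  have szs : size s = ht beta by rewrite -(descend_content wf betaE op) ht_sum_delta.
  (* Every index is in range since [s] has length [ht beta]; here [i] is merely the default value of
     [nth]. *)
  exists [ffun l : 'I_(ht beta) => nth i s l]; rewrite pathsE.
  have -> : codom [ffun l : 'I_(ht beta) => nth i s l] = s.
    apply: (@eq_from_nth _ i) => [|l]; rewrite size_codom_ord // => lN.
    by rewrite (nth_codom_ord _ _ (Ordinal lN)) ffunE.
  by rewrite op.
have [act [act_mod act_e act_x act_tau]] :=
  path_action Asl d_sym Qp P_Ibeta.
split; last first.
  exact: (cvec_basis Asl d_sym Qp La_dom La_min P_Ibeta P_complete act_mod act_e act_tau).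
exists act; split.
- exact: act_mod.
- exact: (act_Saction Asl act_mod act_e act_x act_tau).
- exact: (act_simple Asl La_dom La_min P_Ibeta P_inhabited
    act_mod act_e act_tau).
- exact: (act_graded Asl act_mod act_e act_x act_tau).
- by exists 0 => r v [->|->].
Qed.
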